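(* Let $R$ be a ring, ${}'\mathcal{C}={}'\mathcal{C}_R$, $\mathfrak{a}=\mathrm{ass}_R({}'\mathcal{C})$ and ${}'\mathcal{M}=\{S\in\mathrm{max.Den}_l(R)\mid{}'\mathcal{C}\subseteq S\}$. When $\mathfrak a$ is an ideal of $R$, let $\overline{R}=R/\mathfrak{a}$, $\pi:R\to\overline{R}$, $r\mapsto r+\mathfrak{a}$, and $\overline{{}'\mathcal{C}}=\pi({}'\mathcal{C})$. The following statements are equivalent. 1. ${}'Q_{l,\mathrm{cl}}(R)$ is a semisimple Artinian ring. 2. ${}'\mathcal{M}$ is a finite nonempty set, $\bigcap_{S\in{}'\mathcal{M}}\mathrm{ass}_R(S)=\mathfrak{a}$, for each $S\in{}'\mathcal{M}$ the ring $S^{-1}R$ is a simple Artinian ring, and the set $\overline{{}'\mathcal{C}}$ is a dense subset of $\mathcal{C}_{R/\mathfrak{a}}$ in $R/\mathfrak{a}$. If one of the equivalent conditions holds then: (a) the map ${}'\mathcal{M}\to\overline{\mathcal{M}}:=\mathrm{max.Den}_l(\overline{R})$, $S\mapsto\overline{S}:=\pi(S)$, is a bijection with inverse $T\mapsto\pi^{-1}(T)$; (b) for all $S\in{}'\mathcal{M}$, $\mathfrak{a}\subseteq\mathrm{ass}_R(S)$ and $\pi(\mathrm{ass}_R(S))=\mathrm{ass}_{\overline{R}}(\overline{S})$; for all $T\in\overline{\mathcal{M}}$, $\pi^{-1}(\mathrm{ass}_{\overline{R}}(T))=\mathrm{ass}_R(\pi^{-1}(T))$; (c) for all $S\in{}'\mathcal{M}$,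 $S^{-1}R\simeq\overline{S}^{-1}\overline{R}$ is a simple Artinian ring; (d) ${}'Q_{l,\mathrm{cl}}(R)\simeq\prod_{S\in{}'\mathcal{M}}S^{-1}R\simeq\prod_{S\in{}'\mathcal{M}}\overline{S}^{-1}\overline{R}\simeq\prod_{T\in\overline{\mathcal{M}}}T^{-1}\overline{R}\simeq Q_{l,\mathrm{cl}}(\overline{R})$ (semisimple Artinian rings).
   Context: Rings are associative with $1$. For a nonempty subset $S$ of a ring $R$, $\mathrm{ass}_R(S):=\{r\in R\mid sr=0\text{ for some }s\in S\}$. ${}'\mathcal{C}_R$ is the set of left regular elements of $R$: those $r\in R$ such that $xr=0$ ($x\in R$) implies $x=0$. $\mathcal{C}_R$ is the set of regular elements: those $r$ such that $xr=0$ implies $x=0$ and $rx=0$ implies $x=0$. A multiplicative set is a subset $S$ with $1\in S$, $SS\subseteq S$, $0\notin S$. It is a left Ore set if $Sr\cap Rs\neq\emptyset$ for all $r\in R$, $s\in S$. It is a left denominator set if it is left Ore and $rs=0$ with $r\in R$, $s\in S$ implies $r\in\mathrm{ass}_R(S)$; then $\mathrm{ass}_R(S)$ is an ideal and the left localization $S^{-1}R$ exists. $\mathrm{max.Den}_l(R)$ is the set of left denominator sets of $R$ that are maximal with respect to inclusion. For multiplicative sets $S\subseteq T$ of $R$, $S$ is dense in $T$ if for each $t\in T$ there is $r\in R$ with $rt\in S$. ${}'Q_{l,\mathrm{cl}}(R):={}'\mathcal{C}_R^{-1}R$ and $Q_{l,\mathrm{cl}}(R):=\mathcal{C}_R^{-1}R$;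 these exist exactly when ${}'\mathcal{C}_R$, respectively $\mathcal{C}_R$, is a left denominator set, and an assertion that such a ring has a property includes the assertion that it exists. *)

(* Defs.v *)
From HB Require Import structures.
From mathcomp Require Import all_boot all_algebra generic_quotient.
From mathcomp Require Import boolp classical_sets functions cardinality.

Set Implicit Arguments.
Unset Strict Implicit.
Unset Printing Implicit Defensive.

Import GRing.Theory.

Local Open Scope classical_set_scope.
Local Open Scope ring_scope.
Local Open Scope quotient_scope.

(* Rings are associative with 1 and need not be commutative; pzRingType does
   not exclude the zero ring. *)

Section Subsets.
Variable R : pzRingType.
Implicit Types (S T I : set R).

Definition ass S : set R := [set r | exists2 s, S s & s * r = 0].

(* "Left regular" follows the noncommutative-localization literature; it is
   injectivity of right multiplication by r, i.e. MathComp's GRing.rreg. *)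
Definition left_regular : set R := [set r | forall x, x * r = 0 -> x = 0].

Definition regular : set R :=
  [set r | (forall x, x * r = 0 -> x = 0) /\ (forall x, r * x = 0 -> x = 0)].

Definition multiplicative S : Prop :=
  [/\ S 1, forall s t, S s -> S t -> S (s * t) & ~ S 0].

(* S r and R s have a common element. *)
Definition left_ore S : Prop :=
  multiplicative S /\
  forall r s, S s -> exists2 t, S t & exists u, t * r = u * s.

Definition left_denominator S : Prop :=
  left_ore S /\ forall r s, S s -> r * s = 0 -> ass S r.

Definition max_den : set (set R) :=
  [set S | left_denominator S /\
           forall T, left_denominator T -> S `<=` T -> T = S].

Definition max_den_lreg : set (set R) :=
  [set S | max_den S /\ left_regular `<=` S].

Definition dense S T : Prop :=
  [/\ multiplicative S, multiplicative T, S `<=` T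
    & forall t, T t -> exists r, S (r * t)].

Definition left_ideal I : Prop :=
  [/\ I 0, forall x y, I x -> I y -> I (x + y) & forall a x, I x -> I (a * x)].

Definition right_ideal I : Prop :=
  [/\ I 0, forall x y, I x -> I y -> I (x + y) & forall x a, I x -> I (x * a)].

Definition two_sided_ideal I : Prop := left_ideal I /\ right_ideal I.

Definition minimal_left_ideal I : Prop :=
  [/\ left_ideal I, I <> [set 0]
    & forall J, left_ideal J -> J `<=` I -> J = [set 0] \/ J = I].

Lemma max_den_den S : max_den S -> left_denominator S.
Proof. by case. Qed.

Lemma max_den_lreg_den S : max_den_lreg S -> left_denominator S.
Proof. by case=> -[]. Qed.

End Subsets.

Arguments left_regular R : clear implicits.
Arguments regular R : clear implicits.
Arguments max_den R : clear implicits.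
Arguments max_den_lreg R : clear implicits.

Section RingProperties.
Variable R : pzRingType.

Definition left_artinian : Prop :=
  forall I : nat -> set R, (forall n, left_ideal (I n)) ->
  (forall n, I n.+1 `<=` I n) -> exists n, forall m, (n <= m)%N -> I m = I n.

Definition right_artinian : Prop :=
  forall I : nat -> set R, (forall n, right_ideal (I n)) ->
  (forall n, I n.+1 `<=` I n) -> exists n, forall m, (n <= m)%N -> I m = I n.

Definition artinian : Prop := left_artinian /\ right_artinian.

Definition simple_ring : Prop :=
  (1 : R) <> 0 /\
  forall I : set R, two_sided_ideal I -> I = [set 0] \/ I = setT.

(* R, as a left module over itself, is the sum of its simple submodules. *)
Definition semisimple_ring : Prop :=
  forall x : R, exists n (f : 'I_n -> R),
    (forall i, exists2 I, minimal_left_ideal I & I (f i)) /\ x = \sum_(i < n) f i.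

Definition simple_artinian : Prop := simple_ring /\ artinian.

Definition semisimple_artinian : Prop := semisimple_ring /\ artinian.

End RingProperties.

Definition ring_iso (A B : pzRingType) : Prop :=
  exists f : {rmorphism A -> B}, bijective f.

Section ProductRing.
Variables (I : Type) (A : I -> pzRingType).

Definition prod_ring : Type := forall i, A i.

HB.instance Definition _ := Choice.on prod_ring.

Let add (f g : prod_ring) : prod_ring := fun i => f i + g i.
Let opp (f : prod_ring) : prod_ring := fun i => - f i.
Let mul (f g : prod_ring) : prod_ring := fun i => f i * g i.

Fact prod_addA : associative add.
Proof. by move=> f g h; apply: functional_extensionality_dep => i; apply: addrA. Qed.
Fact prod_addC : commutative add.
Proof. by move=> f g; apply: functional_extensionality_dep => i; apply: addrC. Qed.
Fact prod_add0 : left_id (fun i => 0) add.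
Proof. by move=> f; apply: functional_extensionality_dep => i; apply: add0r. Qed.
Fact prod_addN : left_inverse (fun i => 0) opp add.
Proof. by move=> f; apply: functional_extensionality_dep => i; apply: addNr. Qed.

HB.instance Definition _ :=
  GRing.isZmodule.Build prod_ring prod_addA prod_addC prod_add0 prod_addN.

Fact prod_mulA : associative mul.
Proof. by move=> f g h; apply: functional_extensionality_dep => i; apply: mulrA. Qed.
Fact prod_mul1 : left_id (fun i => 1) mul.
Proof. by move=> f; apply: functional_extensionality_dep => i; apply: mul1r. Qed.
Fact prod_mulr1 : right_id (fun i => 1) mul.
Proof. by move=> f; apply: functional_extensionality_dep => i; apply: mulr1. Qed.
Fact prod_mulDl : left_distributive mul +%R.
Proof. by move=> f g h; apply: functional_extensionality_dep => i; apply: mulrDl. Qed.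
Fact prod_mulDr : right_distributive mul +%R.
Proof. by move=> f g h; apply: functional_extensionality_dep => i; apply: mulrDr. Qed.

HB.instance Definition _ := GRing.Zmodule_isPzRing.Build prod_ring
  prod_mulA prod_mul1 prod_mulr1 prod_mulDl prod_mulDr.

End ProductRing.

(* MathComp's ring_quotient only covers commutative rings. *)
Section QuotientRing.
Variables (R : pzRingType) (I : set R) (hI : two_sided_ideal I).

Definition quot_rel (x y : R) : bool := `[< I (x - y) >].

Let I0 : I 0. Proof. by case: hI => -[]. Qed.
Let ID x y : I x -> I y -> I (x + y). Proof. by case: hI => -[_ + _] _; apply. Qed.
Let IMl a x : I x -> I (a * x). Proof. by case: hI => -[_ _ +] _; apply. Qed.
Let IMr x a : I x -> I (x * a). Proof. by case: hI => _ [_ _ +]; apply. Qed.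
Let IN x : I x -> I (- x). Proof. by rewrite -mulN1r; apply: IMl. Qed.

Fact quot_rel_equiv : equiv_class_of quot_rel.
Proof.
split=> [x|x y|y x z].
- by apply/asboolP; rewrite subrr.
- by apply/asboolP/asboolP => /IN; rewrite opprB.
- by move=> /asboolP xy /asboolP yz; apply/asboolP; have := ID xy yz; rewrite subrKA.
Qed.

Canonical quot_equiv := EquivRelPack quot_rel_equiv.

Definition quot_ring : Type := {eq_quot quot_equiv}.
HB.instance Definition _ := Choice.on quot_ring.
HB.instance Definition _ := EqQuotient.on quot_ring.

Definition quot_pi (x : R) : quot_ring := \pi_quot_ring x.

Lemma quot_piP x y : quot_pi x = quot_pi y <-> I (x - y).
Proof.
split; first by move=> /eqmodP/asboolP.
by move=> h; apply/eqmodP/asboolP.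
Qed.

Lemma quot_pi_surj q : exists x, q = quot_pi x.
Proof. by exists (repr q); rewrite /quot_pi reprK. Qed.

Let add (p q : quot_ring) : quot_ring := quot_pi (repr p + repr q).
Let opp (p : quot_ring) : quot_ring := quot_pi (- repr p).
Let mul (p q : quot_ring) : quot_ring := quot_pi (repr p * repr q).

Let repr_pi x : I (repr (quot_pi x) - x).
Proof. by apply/quot_piP; rewrite /quot_pi reprK. Qed.

Let addE x y : add (quot_pi x) (quot_pi y) = quot_pi (x + y).
Proof. by apply/quot_piP; rewrite opprD addrACA; apply: ID; apply: repr_pi. Qed.
Let oppE x : opp (quot_pi x) = quot_pi (- x).
Proof. by apply/quot_piP; rewrite -opprD; apply: IN; apply: repr_pi. Qed.
Let mulE x y : mul (quot_pi x) (quot_pi y) = quot_pi (x * y).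
Proof.
apply/quot_piP; rewrite -(subrKA (x * repr (quot_pi y))) -mulrBl -mulrBr.
by apply: ID; [apply: IMr | apply: IMl]; apply: repr_pi.
Qed.

Fact quot_addA : associative add.
Proof.
move=> p q r; have [x ->] := quot_pi_surj p; have [y ->] := quot_pi_surj q.
by have [z ->] := quot_pi_surj r; rewrite !addE addrA.
Qed.
Fact quot_addC : commutative add.
Proof.
move=> p q; have [x ->] := quot_pi_surj p; have [y ->] := quot_pi_surj q.
by rewrite !addE addrC.
Qed.
Fact quot_add0 : left_id (quot_pi 0) add.
Proof. by move=> p; have [x ->] := quot_pi_surj p; rewrite addE add0r. Qed.
Fact quot_addN : left_inverse (quot_pi 0) opp add.
Proof. by move=> p; have [x ->] := quot_pi_surj p; rewrite oppE addE addNr. Qed.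

HB.instance Definition _ :=
  GRing.isZmodule.Build quot_ring quot_addA quot_addC quot_add0 quot_addN.

Fact quot_mulA : associative mul.
Proof.
move=> p q r; have [x ->] := quot_pi_surj p; have [y ->] := quot_pi_surj q.
by have [z ->] := quot_pi_surj r; rewrite !mulE mulrA.
Qed.
Fact quot_mul1 : left_id (quot_pi 1) mul.
Proof. by move=> p; have [x ->] := quot_pi_surj p; rewrite mulE mul1r. Qed.
Fact quot_mulr1 : right_id (quot_pi 1) mul.
Proof. by move=> p; have [x ->] := quot_pi_surj p; rewrite mulE mulr1. Qed.
Fact quot_mulDl : left_distributive mul +%R.
Proof.
move=> p q r; have [x ->] := quot_pi_surj p; have [y ->] := quot_pi_surj q.
have [z ->] := quot_pi_surj r; rewrite -[quot_pi x + _]/(add _ _).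
by rewrite -[RHS]/(add _ _) !(addE, mulE) mulrDl.
Qed.
Fact quot_mulDr : right_distributive mul +%R.
Proof.
move=> p q r; have [x ->] := quot_pi_surj p; have [y ->] := quot_pi_surj q.
have [z ->] := quot_pi_surj r; rewrite -[quot_pi y + _]/(add _ _).
by rewrite -[RHS]/(add _ _) !(addE, mulE) mulrDr.
Qed.

HB.instance Definition _ := GRing.Zmodule_isPzRing.Build quot_ring
  quot_mulA quot_mul1 quot_mulr1 quot_mulDl quot_mulDr.

Fact quot_pi_zmod_morphism : zmod_morphism quot_pi.
Proof. by move=> x y; rewrite -[RHS]/(add _ (opp _)) oppE addE. Qed.
Fact quot_pi_monoid_morphism : monoid_morphism quot_pi.
Proof. by split=> // x y; rewrite -[RHS]/(mul _ _) mulE. Qed.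

HB.instance Definition _ :=
  GRing.isZmodMorphism.Build R quot_ring quot_pi quot_pi_zmod_morphism.
HB.instance Definition _ :=
  GRing.isMonoidMorphism.Build R quot_ring quot_pi quot_pi_monoid_morphism.

End QuotientRing.

(* The left localization of R at a left denominator set S: fractions s^-1 r,
   with s1^-1 r1 = s2^-1 r2 when both pairs have a common left multiple with
   denominator in S. *)
Section Localization.
Variables (R : pzRingType) (S : set R) (hS : left_denominator S).

Definition denom : Type := {s : R | s \in S}.
HB.instance Definition _ := Choice.on denom.

Definition loc_rel (p q : denom * R) : bool :=
  `[< exists c d, [/\ S (c * val p.1), c * val p.1 = d * val q.1
                    & c * p.2 = d * q.2] >].

Let S1 : S 1. Proof. by case: hS => -[[]]. Qed.
Let SM s t : S s -> S t -> S (s * t).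
Proof. by case: hS => -[[_ + _] _ _]; apply. Qed.
Let ore r s : S s -> exists2 t, S t & exists u, t * r = u * s.
Proof. by case: hS => -[_ + _]; apply. Qed.
Let cancel a b s : S s -> a * s = b * s -> exists2 t, S t & t * a = t * b.
Proof.
case: hS => _ h Ss ab; have [|t St] := h (a - b) s Ss.
  by rewrite mulrBl ab subrr.
by rewrite mulrBr => /subr0_eq tab; exists t.
Qed.
Let denomP (s : denom) : S (val s). Proof. by have := valP s; rewrite inE. Qed.

Let relP s r s' r' : Prop :=
  exists c d, [/\ S (c * s), c * s = d * s' & c * r = d * r'].

Let relP_sym s r s' r' : relP s r s' r' -> relP s' r' s r.
Proof. by move=> [c [d [h e1 e2]]]; exists d, c; rewrite -e1 -e2. Qed.

Let relP_trans s1 r1 s2 r2 s3 r3 :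
  relP s1 r1 s2 r2 -> relP s2 r2 s3 r3 -> S s2 -> relP s1 r1 s3 r3.
Proof.
move=> [c [d [Sc cd cdr]]] [e [f [Se ef efr]]] Ss2.
have [x Sx [y xy]] := ore (d * s2) Se.
have [||t St txy] := @cancel (x * d) (y * e) s2 => //; first by rewrite -!mulrA.
exists (t * x * c), (t * y * f); split.
- by rewrite -[_ * c * _]mulrA; apply: SM => //; apply: SM.
- by rewrite -!mulrA cd -ef -xy.
- by rewrite -[LHS]mulrA cdr -[RHS]mulrA -efr !mulrA -(mulrA t x) txy !mulrA.
Qed.

Fact loc_rel_equiv : equiv_class_of loc_rel.
Proof.
split=> [p|p q|q p r].
- by apply/asboolP; exists 1, 1; rewrite !mul1r; split=> //; apply: denomP.
- by apply/asboolP/asboolP => h; exact: relP_sym h.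
- move=> /asboolP pq /asboolP qr; apply/asboolP.
  exact: (relP_trans pq qr (denomP _)).
Qed.

Canonical loc_equiv := EquivRelPack loc_rel_equiv.

Definition loc : Type := {eq_quot loc_equiv}.
HB.instance Definition _ := Choice.on loc.
HB.instance Definition _ := EqQuotient.on loc.

(* The fraction s^-1 r. *)
Definition frac (s : R) (Ss : S s) (r : R) : loc :=
  \pi_loc (exist (fun s => s \in S) s (mem_set Ss), r).

Lemma fracP s (Ss : S s) r s' (Ss' : S s') r' :
  frac Ss r = frac Ss' r' <->
  exists c d, [/\ S (c * s), c * s = d * s' & c * r = d * r'].
Proof.
split; first by move=> /eqmodP/asboolP.
by move=> h; apply/eqmodP/asboolP.
Qed.

Lemma frac_surj q : exists s (Ss : S s) r, q = frac Ss r.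
Proof.
case: (repr q) (reprK q) => s r <-.
exists (val s), (denomP s), r; congr (\pi_loc (_, r)); exact: val_inj.
Qed.

Lemma frac_scale c s (Ss : S s) (Scs : S (c * s)) r :
  frac Ss r = frac Scs (c * r).
Proof. by apply/fracP; exists c, 1; rewrite !mul1r. Qed.

Lemma frac_common2 p q :
  exists s (Ss : S s) a b, p = frac Ss a /\ q = frac Ss b.
Proof.
have [s [Ss [a ->]]] := frac_surj p; have [t [St [b ->]]] := frac_surj q.
have [x Sx [y xy]] := ore s St.
have Sxs : S (x * s) by apply: SM.
have Syt : S (y * t) by rewrite -xy.
exists (x * s), Sxs, (x * a), (y * b); split; first exact: frac_scale.
by rewrite (frac_scale St Syt); apply/fracP; exists 1, 1; rewrite !mul1r xy.
Qed.

Lemma frac_common3 p q w : exists s (Ss : S s) a b c,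
  [/\ p = frac Ss a, q = frac Ss b & w = frac Ss c].
Proof.
have [s [Ss [a [b [-> ->]]]]] := frac_common2 p q.
have [t [St [c ->]]] := frac_surj w; have [x Sx [y xy]] := ore s St.
have Sxs : S (x * s) by apply: SM.
have Syt : S (y * t) by rewrite -xy.
exists (x * s), Sxs, (x * a), (x * b), (y * c); split; try exact: frac_scale.
by rewrite (frac_scale St Syt); apply/fracP; exists 1, 1; rewrite !mul1r xy.
Qed.

(* s^-1 a + s^-1 b = s^-1 (a + b) *)
Let add_spec (p q w : loc) : Prop := exists s (Ss : S s) a b,
  [/\ p = frac Ss a, q = frac Ss b & w = frac Ss (a + b)].

Let add_ex p q : exists w, add_spec p q w.
Proof.
have [s [Ss [a [b [-> ->]]]]] := frac_common2 p q.
by exists (frac Ss (a + b)), s, Ss, a, b.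
Qed.

Let add_uniq p q w w' : add_spec p q w -> add_spec p q w' -> w = w'.
Proof.
move=> [s [Ss [a [b [-> -> ->]]]]] [s' [Ss' [a' [b' [/fracP pE /fracP qE ->]]]]].
have [c [d [Sc cd cda]]] := pE; have [e [f [Se ef efb]]] := qE.
have [x Sx [y xy]] := ore (c * s) Se.
have [||t St txy] := @cancel (x * c) (y * e) s => //; first by rewrite -!mulrA.
have [||t' St' txy'] := @cancel (t * x * d) (t * y * f) s' => //.
  by rewrite -!mulrA -cd -ef xy.
apply/fracP; exists (t' * t * x * c), (t' * t * x * d); split.
- by rewrite -!mulrA; do 3! [apply: SM => //].
- by rewrite -!mulrA cd.
- rewrite !mulrDr; congr (_ + _); first by rewrite -!mulrA cda.
  rewrite -!mulrA (mulrA x) (mulrA t) txy -!mulrA efb.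
  by move: (congr1 ( *%R^~ b') txy'); rewrite -!mulrA.
Qed.

(* (s^-1 (a t)) (t^-1 b) = s^-1 (a b) *)
Let mul_spec (p q w : loc) : Prop :=
  exists s (Ss : S s) t (St : S t) a b,
  [/\ p = frac Ss (a * t), q = frac St b & w = frac Ss (a * b)].

Let frac_ore s (Ss : S s) r t (St : S t) : exists s' (Ss' : S s') x y,
  [/\ s' = x * s, x * r = y * t & frac Ss r = frac Ss' (y * t)].
Proof.
have [x Sx [y xy]] := ore r St; exists (x * s), (SM Sx Ss), x, y; split=> //.
by rewrite -xy; apply: frac_scale.
Qed.

Let mul_ex p q : exists w, mul_spec p q w.
Proof.
have [s [Ss [r ->]]] := frac_surj p; have [t [St [b ->]]] := frac_surj q.
have [s' [Ss' [x [a [_ _ ->]]]]] := frac_ore Ss r St.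
by exists (frac Ss' (a * b)), s', Ss', t, St, a, b.
Qed.

Let mul_uniq p q w w' : mul_spec p q w -> mul_spec p q w' -> w = w'.
Proof.
move=> [s [Ss [t [St [a [b [-> -> ->]]]]]]].
move=> [s' [Ss' [t' [St' [a' [b' [/fracP pE /fracP qE ->]]]]]]].
have [c [d [Sc cd cda]]] := pE; have [e [f [Se ef efb]]] := qE.
have [x Sx [y xy]] := ore (c * a * t) Se.
have [||u Su uxy] := @cancel (x * c * a) (y * e) t => //.
  by rewrite -!mulrA; move: xy; rewrite -!mulrA.
have [||v Sv vxy] := @cancel (u * x * d * a') (u * y * f) t' => //.
  by rewrite -!mulrA -cda -ef; move: xy; rewrite -!mulrA => ->.
apply/fracP; exists (v * u * x * c), (v * u * x * d); split.
- by rewrite -!mulrA; do 3! [apply: SM => //].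
- by rewrite -!mulrA cd.
- have -> : v * u * x * c * (a * b) = v * (u * (x * c * a)) * b by rewrite !mulrA.
  rewrite uxy -!mulrA efb.
  by move: (congr1 ( *%R^~ b') vxy); rewrite -!mulrA.
Qed.

Let add p q : loc := projT1 (cid (add_ex p q)).
Let mul p q : loc := projT1 (cid (mul_ex p q)).
Let opp p : loc := mul (frac S1 (- 1)) p.

Let addE s (Ss : S s) a b : add (frac Ss a) (frac Ss b) = frac Ss (a + b).
Proof.
rewrite /add; case: cid => w /= hw; apply: (add_uniq hw).
by exists s, Ss, a, b.
Qed.

Let mulE s (Ss : S s) t (St : S t) a b :
  mul (frac Ss (a * t)) (frac St b) = frac Ss (a * b).
Proof.
rewrite /mul; case: cid => w /= hw; apply: (mul_uniq hw).
by exists s, Ss, t, St, a, b.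
Qed.

Let frac0 s (Ss : S s) : frac Ss 0 = frac S1 0.
Proof. by apply/fracP; exists 1, s; rewrite !mul1r !mulr1 mulr0. Qed.

Let frac1 s (Ss : S s) : frac Ss s = frac S1 1.
Proof. by apply/fracP; exists 1, s; rewrite !mul1r !mulr1. Qed.

Let oppE s (Ss : S s) a : opp (frac Ss a) = frac Ss (- a).
Proof.
rewrite /opp.
have -> : frac S1 (- 1) = frac Ss (- 1 * s).
  by apply/fracP; exists s, 1; rewrite !mul1r !mulr1 mulrN1 mulN1r.
by rewrite mulE mulN1r.
Qed.

Fact loc_addA : associative add.
Proof.
move=> p q w; have [s [Ss [a [b [c [-> -> ->]]]]]] := frac_common3 p q w.
by rewrite !addE addrA.
Qed.
Fact loc_addC : commutative add.
Proof.
move=> p q; have [s [Ss [a [b [-> ->]]]]] := frac_common2 p q.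
by rewrite !addE addrC.
Qed.
Fact loc_add0 : left_id (frac S1 0) add.
Proof.
by move=> p; have [s [Ss [a ->]]] := frac_surj p; rewrite -(frac0 Ss) addE add0r.
Qed.
Fact loc_addN : left_inverse (frac S1 0) opp add.
Proof.
by move=> p; have [s [Ss [a ->]]] := frac_surj p; rewrite oppE addE addNr frac0.
Qed.

HB.instance Definition _ :=
  GRing.isZmodule.Build loc loc_addA loc_addC loc_add0 loc_addN.

Fact loc_mulA : associative mul.
Proof.
move=> p q w; have [u [Su [c ->]]] := frac_surj w.
have [t [St [r ->]]] := frac_surj q; have [s [Ss [r' ->]]] := frac_surj p.
have [t' [St' [_ [b [_ _ ->]]]]] := frac_ore St r Su.
have [s' [Ss' [_ [a [_ _ ->]]]]] := frac_ore Ss r' St'.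
by rewrite !mulE !mulrA mulE.
Qed.
Fact loc_mul1 : left_id (frac S1 1) mul.
Proof.
move=> p; have [s [Ss [a ->]]] := frac_surj p.
by rewrite -(frac1 Ss) -[X in frac Ss X]mul1r mulE mul1r.
Qed.
Fact loc_mulr1 : right_id (frac S1 1) mul.
Proof.
move=> p; have [s [Ss [a ->]]] := frac_surj p.
by rewrite -[in LHS](mulr1 a) mulE mulr1.
Qed.
Fact loc_mulDl : left_distributive mul +%R.
Proof.
move=> p q w; rewrite -[p + q]/(add p q) -[RHS]/(add _ _).
have [t [St [c ->]]] := frac_surj w.
have [s [Ss [a [b [-> ->]]]]] := frac_common2 p q.
have [x Sx [a' xa]] := ore a St; have [y Sy [b' yb]] := ore (x * b) St.
have Syx : S (y * x * s) by rewrite -mulrA; apply: SM => //; apply: SM.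
rewrite !(frac_scale Ss Syx).
have -> : y * x * a = y * a' * t by rewrite -!mulrA xa.
have -> : y * x * b = b' * t by rewrite -mulrA yb.
by rewrite addE -mulrDl !mulE addE mulrDl.
Qed.
Fact loc_mulDr : right_distributive mul +%R.
Proof.
move=> w p q; rewrite -[p + q]/(add p q) -[RHS]/(add _ _).
have [t [St [a [b [-> ->]]]]] := frac_common2 p q.
have [s [Ss [r ->]]] := frac_surj w.
have [s' [Ss' [_ [c [_ _ ->]]]]] := frac_ore Ss r St.
by rewrite addE !mulE addE mulrDr.
Qed.

HB.instance Definition _ := GRing.Zmodule_isPzRing.Build loc
  loc_mulA loc_mul1 loc_mulr1 loc_mulDl loc_mulDr.

Lemma frac_add s (Ss : S s) a b : frac Ss a + frac Ss b = frac Ss (a + b).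
Proof. exact: addE. Qed.

Lemma frac_mul s (Ss : S s) t (St : S t) a b :
  frac Ss (a * t) * frac St b = frac Ss (a * b).
Proof. exact: mulE. Qed.

Lemma frac_one s (Ss : S s) : frac Ss s = 1.
Proof. exact: frac1. Qed.

Lemma frac_zero s (Ss : S s) : frac Ss 0 = 0.
Proof. exact: frac0. Qed.

(* The canonical map R -> S^-1 R, r |-> 1^-1 r. *)
Definition loc_in (r : R) : loc := frac S1 r.

Fact loc_in_zmod_morphism : zmod_morphism loc_in.
Proof. by move=> x y; rewrite -[RHS]/(add _ (opp _)) oppE addE. Qed.
Fact loc_in_monoid_morphism : monoid_morphism loc_in.
Proof.
split=> // x y; rewrite -[RHS]/(mul _ _).
by rewrite -[in RHS](mulr1 x) mulE.
Qed.

HB.instance Definition _ :=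
  GRing.isZmodMorphism.Build R loc loc_in loc_in_zmod_morphism.
HB.instance Definition _ :=
  GRing.isMonoidMorphism.Build R loc loc_in loc_in_monoid_morphism.

Lemma frac_inv s (Ss : S s) : frac Ss 1 * loc_in s = 1 /\ loc_in s * frac Ss 1 = 1.
Proof.
split; last by rewrite /loc_in -{1}[s]mul1r frac_mul mulr1.
by rewrite -[in LHS](mulr1 1) frac_mul mul1r frac_one.
Qed.

Lemma fracE s (Ss : S s) r : frac Ss r = frac Ss 1 * loc_in r.
Proof. by rewrite -[1 in RHS](mulr1 1) frac_mul mul1r. Qed.

Lemma loc_in_eq0 r : loc_in r = 0 <-> ass S r.
Proof.
rewrite -(frac_zero S1); split.
  move=> /fracP [c [d [Sc _]]]; rewrite mulr1 in Sc; rewrite mulr0 => cr.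
  by exists c.
move=> [s Ss sr]; apply/fracP; exists s, s.
by rewrite !mulr1 mulr0.
Qed.

End Localization.

(* Main.v *)
Require Import Defs.
From HB Require Import structures.
From mathcomp Require Import all_boot all_algebra.
From mathcomp Require Import boolp classical_sets functions cardinality.

Set Implicit Arguments.
Unset Strict Implicit.
Unset Printing Implicit Defensive.

Import GRing.Theory.

Local Open Scope classical_set_scope.
Local Open Scope ring_scope.

(** Let [f : R -> Q] be a left localization at a set [C] of left regular elements
    of [R], with [Q] semisimple artinian.  Such a [Q] has finitely many maximal
    ideals [m] meeting in zero, the annihilators of the simple summands of [Q]
    ([semisimple_maximal_ideals]), so [Q] is the product of the simple artinian
    rings [Q / m].  Put [S_m = {r | f r is a unit modulo m}].  As [Q / m] is a
    direct factor of [Q], it is the localization of [R] at [S_m], with kernel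
    [ass S_m = f^-1 m].  The crux is that every left denominator set [T] of [R],
    whether or not it contains [C], lies in some [S_m] ([left_denominator_sub]):
    the left ideal of [Q] generated by the image of [ass T] is two-sided because
    [Q] is artinian, it is proper because elements of [C] are left regular, and
    the elements of [T] become units modulo it.  Hence the maximal left
    denominator sets of [R] are exactly the [S_m] ([max_denP]).

    The same applies to the quotient of [R] by [a = ass C], which embeds in [Q]
    and has [Q] as its localization at the image of [C], and also at all its
    regular elements: left regular elements of the quotient become left regular,
    hence invertible, in the artinian ring [Q].  So the maximal left denominator
    sets of [R] and of its quotient are the preimages of the same sets of units
    modulo the [m], and all the rings in (c) and (d) are factors of [Q] or
    products of them.

    Conversely, suppose that the localizations at the maximal denominator sets
    [S] containing the left regular elements are simple artinian.  Maximality
    makes the ideals [ass S] pairwise incomparable ([max_den_ass_inj]), and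
    simplicity then yields in each [S] an element of all the other [ass S']
    ([max_den_separated]).  With these elements the finitely many components of
    an element of the product of the [S^-1 R] acquire a common denominator [s].
    The image of [s] in the quotient by [a] is regular, so density provides a
    multiple of [s] congruent to a left regular element modulo [a]; thus the
    product is the localization of [R] at its left regular elements.  A finite
    product of simple artinian rings is semisimple artinian by Chinese remainders
    ([prod_semisimple_artinian]). *)

(** * Units, ideals and chain conditions *)

Definition invertible (A : pzRingType) : set A :=
  [set x | exists y, y * x = 1 /\ x * y = 1].

Section Invertible.
Variable A : pzRingType.
Implicit Types x y : A.

Lemma invertible1 : invertible (1 : A).
Proof. by exists 1; rewrite mulr1. Qed.

Lemma invertibleM x y : invertible x -> invertible y -> invertible (x * y).
Proof.
move=> [x' [x'x xx']] [y' [y'y yy']]; exists (y' * x'); split.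
  by rewrite mulrA -(mulrA y') x'x mulr1.
by rewrite mulrA -(mulrA x) yy' mulr1.
Qed.

Lemma invertible_eq0 x y : invertible x -> x * y = 0 -> y = 0.
Proof. by move=> [z [zx _]] xy0; rewrite -[y]mul1r -zx -mulrA xy0 mulr0. Qed.

Lemma invertible_left_regular x : invertible x -> left_regular A x.
Proof. by move=> [z [_ xz]] y yx; rewrite -[y]mulr1 -xz mulrA yx mul0r. Qed.

Lemma invertible_inj x y z : invertible x -> x * y = x * z -> y = z.
Proof.
move=> ix e; apply: subr0_eq; apply: (invertible_eq0 ix).
by rewrite mulrBr e subrr.
Qed.

Lemma left_regularX x n : left_regular A x -> left_regular A (x ^+ n).
Proof.
move=> rx; elim: n => [|n IH] y; first by rewrite mulr1.
by rewrite exprS mulrA => /IH /rx.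
Qed.

End Invertible.

Lemma invertible_rmorph (A B : pzRingType) (f : {rmorphism A -> B}) x :
  invertible x -> invertible (f x).
Proof. by move=> [y [yx xy]]; exists (f y); rewrite -!rmorphM yx xy rmorph1. Qed.

Lemma exists_rmorphism (A B : pzRingType) (g : A -> B) :
  zmod_morphism g -> monoid_morphism g -> exists h : {rmorphism A -> B}, h =1 g.
Proof.
move=> ga gm.
pose a := GRing.isZmodMorphism.Build A B g ga.
pose m := GRing.isMonoidMorphism.Build A B g gm.
by exists (HB.pack g a m : {rmorphism A -> B}).
Qed.

Section Ideals.
Variable A : pzRingType.
Implicit Types I J m : set A.

Lemma left_idealN I x : left_ideal I -> I x -> I (- x).
Proof. by move=> [_ _ IM] Ix; rewrite -mulN1r; apply: IM. Qed.

Lemma left_idealB I x y : left_ideal I -> I x -> I y -> I (x - y).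
Proof. by move=> hI Ix Iy; have [_ ID _] := hI; apply: ID => //; apply: left_idealN. Qed.

Lemma two_sided_left I : two_sided_ideal I -> left_ideal I.
Proof. by case. Qed.

Lemma two_sidedMr I x y : two_sided_ideal I -> I x -> I (x * y).
Proof. by move=> [_ [_ _ IM]]; apply: IM. Qed.

Lemma two_sidedMl I x y : two_sided_ideal I -> I y -> I (x * y).
Proof. by move=> [[_ _ IM] _]; apply: IM. Qed.

Lemma two_sided0 : two_sided_ideal [set 0 : A].
Proof.
by split; split=> //= *; subst; rewrite ?addr0 ?mulr0 ?mul0r.
Qed.

Lemma left_ideal_full I x : left_ideal I -> I 1 -> I x.
Proof. by move=> [_ _ IM] I1; rewrite -[x]mulr1; apply: IM. Qed.

Lemma left_ideal_cap I J : left_ideal I -> left_ideal J -> left_ideal (I `&` J).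
Proof.
move=> [I0 ID IM] [J0 JD JM]; split=> // [x y [Ix Jx] [Iy Jy]|a x [Ix Jx]].
  by split; [apply: ID | apply: JD].
by split; [apply: IM | apply: JM].
Qed.

Lemma two_sided_add I J : two_sided_ideal I -> two_sided_ideal J ->
  two_sided_ideal [set x | exists2 a, I a & J (x - a)].
Proof.
move=> [[I0 ID IM] [_ _ IMr]] [[J0 JD JM] [_ _ JMr]].
have h0 : [set x | exists2 a, I a & J (x - a)] 0 by exists 0; rewrite ?subrr.
have hD x y : [set x | exists2 a, I a & J (x - a)] x ->
    [set x | exists2 a, I a & J (x - a)] y ->
    [set x | exists2 a, I a & J (x - a)] (x + y).
  move=> [a Ia Ja] [b Ib Jb]; exists (a + b); first exact: ID.
  by rewrite opprD addrACA; apply: JD.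
split; (split=> //; try exact: hD); [move=> c x [a Ia Ja]|move=> x c [a Ia Ja]].
  by exists (c * a); [apply: IM | rewrite -mulrBr; apply: JM].
by exists (a * c); [apply: IMr | rewrite -mulrBl; apply: JMr].
Qed.

(** The set [S] stands for a set of denominators, or for the congruence class
    [1 + I] of an ideal; in both cases it is the closure under products that
    turns separate intersections into a simultaneous one. *)
Lemma meets_bigcap (S : set A) (l : seq (set A)) :
  S 1 -> (forall x y, S x -> S y -> S (x * y)) ->
  (forall I, I \in l -> two_sided_ideal I /\ exists2 x, S x & I x) ->
  exists2 x, S x & forall I, I \in l -> I x.
Proof.
move=> S1 SM; elim: l => [|J l IH] hl; first by exists 1.
have [|x Sx xl] := IH; first by move=> I Il; apply: hl; rewrite inE Il orbT.
have [|hJ [y Sy Jy]] := hl J; first by rewrite inE eqxx.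
exists (x * y); first exact: SM.
move=> I; rewrite inE => /predU1P[->|Il]; first exact: two_sidedMl.
by apply: two_sidedMr; [case: (hl I) => //; rewrite inE Il orbT | apply: xl].
Qed.

Lemma congr1_mul I x y : two_sided_ideal I -> I (x - 1) -> I (y - 1) -> I (x * y - 1).
Proof.
move=> hI Ix Iy; have -> : x * y - 1 = x * (y - 1) + (x - 1).
  by rewrite mulrBr mulr1 subrKA.
by have [[_ ID _] _] := hI; apply: ID => //; apply: two_sidedMl.
Qed.

Definition maximal_ideal m : Prop :=
  [/\ two_sided_ideal m, ~ m 1
    & forall I, two_sided_ideal I -> m `<=` I -> ~ I 1 -> I `<=` m].

Lemma maximal_coprime m I : maximal_ideal m -> two_sided_ideal I ->
  ~ (I `<=` m) -> exists2 x, I x & m (x - 1).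
Proof.
move=> [hm _ mmax] hI nIm; have [m0 _ _] := two_sided_left hm.
have [I0 _ _] := two_sided_left hI.
have [[a Ia ma]|n1] := pselect (exists2 a, I a & m (1 - a)).
  by exists a => //; rewrite -opprB; apply: left_idealN (two_sided_left hm) _.
exfalso; apply: nIm => x Ix.
apply: (mmax _ (two_sided_add hI hm) _ n1); last by exists x; rewrite ?subrr.
by move=> y my; exists 0; rewrite ?subr0.
Qed.

Lemma maximal_comaximal m m' : maximal_ideal m -> maximal_ideal m' -> m' <> m ->
  exists2 x, m' x & m (x - 1).
Proof.
move=> mm mm' nmm'; have [hm m1 _] := mm; have [hm' _ maxm'] := mm'.
apply: (maximal_coprime mm hm') => sm'm; apply: nmm'; apply/seteqP; split=> //.
exact: maxm'.
Qed.

Lemma comaximal_sep (ms : seq (set A)) m :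
  (forall m, m \in ms -> maximal_ideal m) -> m \in ms ->
  exists2 e, m (e - 1) & forall m', m' \in ms -> m' <> m -> m' e.
Proof.
move=> hms mms; have [hm _ _] := hms _ mms.
have [m0 _ _] := two_sided_left hm.
have [|x y mx my|I|e me eP] := @meets_bigcap [set x | m (x - 1)] (filter (predC1 m) ms).
- by rewrite /= subrr.
- exact: congr1_mul.
- rewrite mem_filter => /andP[/eqP Im Ims]; have mI := hms _ Ims.
  split; first by case: mI.
  by have [x Ix mx] := maximal_comaximal (hms _ mms) mI Im; exists x.
- exists e => // m' m'ms nm; apply: eP.
  by rewrite mem_filter m'ms andbT; apply/eqP.
Qed.

(** The usual successive correction [z + e (y - z)] multiplies on the left only,
    so it stays in a left ideal [I] containing the local solutions [y].  With [I]
    the whole ring this is the Chinese remainder theorem; proper [I] serve for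
    chain conditions. *)
Lemma crt_in (ms : seq (set A)) I (x : set A -> A) :
  (forall m, m \in ms -> maximal_ideal m) -> left_ideal I ->
  (forall m, m \in ms -> exists2 y, I y & m (x m - y)) ->
  exists2 z, I z & forall m, m \in ms -> m (x m - z).
Proof.
move=> hms hI hx; have [I0 ID IM] := hI.
suff H (l : seq (set A)) : {subset l <= ms} ->
    exists2 z, I z & forall m, m \in l -> m (x m - z).
  exact: H.
elim: l => [|m l IH] sl; first by exists 0.
have [|z Iz zP] := IH; first by move=> m' h; apply: sl; rewrite inE h orbT.
have mms : m \in ms by apply: sl; rewrite inE eqxx.
have [e me eP] := comaximal_sep hms mms.
have [y Iy my] := hx _ mms.
exists (z + e * (y - z)); first by apply: ID => //; apply: IM; apply: left_idealB.
have em : m (x m - (z + e * (y - z))).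
  have [hm _ _] := hms _ mms; have [_ mD _] := two_sided_left hm.
  have -> : x m - (z + e * (y - z)) = (x m - y) - (e - 1) * (y - z).
    by rewrite mulrBl mul1r opprB !addrA subrK opprD addrA.
  by apply: (left_idealB (two_sided_left hm)) => //; apply: two_sidedMr.
move=> m'; rewrite inE => /predU1P[-> //|m'l].
have [->//|nm] := pselect (m' = m).
have m'ms : m' \in ms by apply: sl; rewrite inE m'l orbT.
have [hm' _ _] := hms _ m'ms; rewrite opprD addrA.
apply: (left_idealB (two_sided_left hm')); first exact: zP.
by apply: two_sidedMr => //; apply: eP.
Qed.

(** If [I] were coprime to each member of [ms], the class [1 + I] would meet each
    of them, hence their intersection, which is zero. *)
Lemma proper_sub_maximal (ms : seq (set A)) I :
  (forall m, m \in ms -> maximal_ideal m) ->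
  (forall x, (forall m, m \in ms -> m x) -> x = 0) ->
  two_sided_ideal I -> ~ I 1 -> exists2 m, m \in ms & I `<=` m.
Proof.
move=> hms ms0 hI I1; apply: contrapT => h; apply: I1.
have [I0 _ _] := two_sided_left hI.
have [|x y Ix Iy|m mms|x Ix xP] := @meets_bigcap [set x | I (x - 1)] ms.
- by rewrite /= subrr.
- exact: congr1_mul.
- have mm := hms _ mms; split; first by case: mm.
  have [|x Ix mx] := maximal_coprime mm hI; first by move=> sub; apply: h; exists m.
  exists (1 - x); last first.
    rewrite -opprB; case: mm => hm _ _.
    exact: left_idealN (two_sided_left hm) mx.
  by rewrite /= addrC addrA addNr sub0r; apply: left_idealN (two_sided_left hI) _.
- have x0 := ms0 x xP; move: Ix; rewrite /= x0 sub0r => Ix.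
  by rewrite -[1]opprK; apply: left_idealN (two_sided_left hI) _.
Qed.

End Ideals.

Section Preimages.
Variables (A B : pzRingType) (g : {rmorphism A -> B}).

Lemma preim_left_ideal I : left_ideal I -> left_ideal (g @^-1` I).
Proof.
move=> [I0 ID IM]; split=> [|x y|a x] /=; rewrite ?(rmorph0, rmorphD, rmorphM) //.
  exact: ID.
exact: IM.
Qed.

Lemma preim_right_ideal I : right_ideal I -> right_ideal (g @^-1` I).
Proof.
move=> [I0 ID IM]; split=> [|x y|a x] /=; rewrite ?(rmorph0, rmorphD, rmorphM) //.
  exact: ID.
exact: IM.
Qed.

Lemma preim_two_sided I : two_sided_ideal I -> two_sided_ideal (g @^-1` I).
Proof. by move=> [? ?]; split; [apply: preim_left_ideal|apply: preim_right_ideal]. Qed.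

Hypothesis gsurj : forall b, exists a, g a = b.

Lemma preim_surj_eq I J : g @^-1` I = g @^-1` J -> I = J.
Proof.
move=> e; apply/seteqP; split=> b h; have [a ga] := gsurj b.
  by move: (congr1 (fun X => X a) e) => /= {e}; rewrite ga => <-.
by move: (congr1 (fun X => X a) e) => /= {e}; rewrite ga => ->.
Qed.

Lemma image_left_ideal I : left_ideal I -> left_ideal (g @` I).
Proof.
move=> [I0 ID IM]; split=> [|_ _ [x Ix <-] [y Iy <-]|b _ [x Ix <-]].
- by exists 0; rewrite ?rmorph0.
- by exists (x + y); rewrite ?rmorphD //; apply: ID.
- by have [a <-] := gsurj b; exists (a * x); rewrite ?rmorphM //; apply: IM.
Qed.

Lemma image_right_ideal I : right_ideal I -> right_ideal (g @` I).
Proof.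
move=> [I0 ID IM]; split=> [|_ _ [x Ix <-] [y Iy <-]|_ b [x Ix <-]].
- by exists 0; rewrite ?rmorph0.
- by exists (x + y); rewrite ?rmorphD //; apply: ID.
- by have [a <-] := gsurj b; exists (x * a); rewrite ?rmorphM //; apply: IM.
Qed.

Lemma artinian_surj : artinian A -> artinian B.
Proof.
move=> [la ra]; split=> I hI dI.
  have [n||n nP] := la (fun n => g @^-1` I n); first exact: preim_left_ideal.
    by move=> n x; apply: dI.
  by exists n => m /nP /preim_surj_eq.
have [n||n nP] := ra (fun n => g @^-1` I n); first exact: preim_right_ideal.
  by move=> n x; apply: dI.
by exists n => m /nP /preim_surj_eq.
Qed.

Lemma simple_surj : maximal_ideal (g @^-1` [set 0]) -> simple_ring B.
Proof.
move=> [_ m1 mmax]; split; first by move=> e; apply: m1; rewrite /= rmorph1.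
move=> I hI; have [I0 _ _] := two_sided_left hI.
have [I1|nI1] := pselect (I 1); [right|left]; apply/seteqP; split=> // b.
- by move=> _; apply: left_ideal_full => //; apply: two_sided_left.
- move=> Ib; have [a ab] := gsurj b; rewrite -ab.
  apply: (mmax _ (preim_two_sided hI)) => /=; rewrite ?ab // ?rmorph1 //.
  by move=> x /= ->.
- by move=> ->.
Qed.

Lemma simple_ker_maximal : simple_ring B -> maximal_ideal (g @^-1` [set 0]).
Proof.
move=> [B1 Bs]; split=> [||I hI kI I1].
- exact: preim_two_sided (two_sided0 _).
- by rewrite /= rmorph1.
have [_ ID _] := two_sided_left hI.
have gI : two_sided_ideal (g @` I).
  by case: hI => ? ?; split; [apply: image_left_ideal | apply: image_right_ideal].
case: (Bs _ gI) => [e x Ix|e].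
  by move: (imageP g Ix); rewrite e.
have [x Ix gx] : (g @` I) 1 by rewrite e.
case: I1; rewrite -(subrK x 1); apply: ID => //; apply: kI.
by rewrite /= rmorphB rmorph1 gx subrr.
Qed.

End Preimages.

Section Chains.
Variable A : pzRingType.
Hypothesis Aart : left_artinian A.

(** The descending chain of left ideals [A x^n] stabilises, so that
    [x^n = z x^(n+1)] and [z x = 1]. *)
Lemma artinian_left_regular (x : A) : left_regular A x -> invertible x.
Proof.
move=> rx; pose I n : set A := [set y | exists z, y = z * x ^+ n].
have [n|n y [z ->]|n nP] := Aart (I := I).
- split=> [|y y' [z ->] [z' ->]|a y [z ->]].
  + by exists 0; rewrite mul0r.
  + by exists (z + z'); rewrite mulrDl.
  + by exists (a * z); rewrite mulrA.
- by exists (z * x); rewrite exprS mulrA.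
have [z ez] : I n.+1 (x ^+ n) by rewrite nP //; exists 1; rewrite mul1r.
have zx : z * x = 1.
  apply/esym/subr0_eq; apply: (left_regularX (n := n) rx).
  by rewrite mulrBl mul1r -mulrA -exprS -ez subrr.
exists z; split=> //; apply: subr0_eq; apply: rx.
by rewrite mulrBl mul1r -mulrA zx mulr1 subrr.
Qed.

(** The chain [L c^n] of left ideals stabilises, so that [y c^(n+1)], which lies
    in [L c^n], is also [z c^(n+1)] for some [z] in [L]; cancel [c^(n+1)]. *)
Lemma artinian_ideal_divr (L : set A) (c y : A) : left_ideal L -> invertible c ->
  (forall x, L x -> L (x * c)) -> L (y * c) -> L y.
Proof.
move=> [L0 LD LM] ic Lc Lyc.
pose I n : set A := [set x | exists2 z, L z & x = z * c ^+ n].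
have [n|n x [z Lz ->]|n nP] := Aart (I := I).
- split=> [|x x' [z Lz ->] [z' Lz' ->]|a x [z Lz ->]].
  + by exists 0; rewrite ?mul0r.
  + by exists (z + z'); rewrite ?mulrDl //; apply: LD.
  + by exists (a * z); rewrite ?mulrA //; apply: LM.
- by exists (z * c); rewrite ?exprS ?mulrA //; apply: Lc.
have [z Lz ez] : I n.+1 (y * c ^+ n.+1).
  by rewrite exprS mulrA nP //; exists (y * c).
have -> // : y = z; apply: subr0_eq.
have := left_regularX (n := n.+1) (invertible_left_regular ic); apply.
by rewrite mulrBl ez subrr.
Qed.

Lemma minimal_left_ideal_in (N : set A) : left_ideal N -> N <> [set 0] ->
  exists2 L, minimal_left_ideal L & L `<=` N.
Proof.
move=> hN N0; apply: contrapT => nmin.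
pose P (J : set A) := [/\ left_ideal J, J <> [set 0] & J `<=` N].
have step (J : set A) : exists K, P J -> [/\ P K, K `<=` J & K <> J].
  have [[hJ J0 JN]|nP] := pselect (P J); last by exists J.
  apply: contrapT => nK; apply: nmin; exists J => //; split=> // K hK KJ.
  have [->|K0] := pselect (K = [set 0]); [by left | right].
  apply: contrapT => nKJ; apply: nK; exists K => _; split=> //; split=> //.
  by move=> x /KJ /JN.
have [nxt nxtP] := choice step.
pose I n := iter n nxt N.
have PI n : P (I n) by elim: n => [|n /nxtP[]] //; split=> // x.
have [n|n|n nP] := Aart (I := I); first by case: (PI n).
  by case: (nxtP _ (PI n)).
by case: (nxtP _ (PI n)) => _ _; apply; exact: (nP n.+1).
Qed.

End Chains.

(** * Semisimple rings and their maximal ideals *)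

Section Semisimple.
Variable A : pzRingType.

Definition annihilator (L : set A) : set A := [set x | forall y, L y -> x * y = 0].

Definition socle : set A := [set x | exists n (f : 'I_n -> A),
  (forall i, exists2 I, minimal_left_ideal I & I (f i)) /\ x = \sum_(i < n) f i].

Lemma minimal_eq (L I : set A) x : minimal_left_ideal L -> left_ideal I ->
  I `<=` L -> I x -> x <> 0 -> I = L.
Proof.
move=> [_ _ Lm] hI sIL Ix x0; case: (Lm _ hI sIL) => // e.
by case: x0; move: Ix; rewrite e.
Qed.

Lemma left_ideal_mulr (L : set A) x : left_ideal L -> left_ideal [set l * x | l in L].
Proof.
move=> [L0 LD LM]; split=> [|_ _ [y Ly <-] [z Lz <-]|a _ [y Ly <-]].
- by exists 0; rewrite ?mul0r.
- by exists (y + z); rewrite ?mulrDl //; apply: LD.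
- by exists (a * y); rewrite ?mulrA //; apply: LM.
Qed.

Lemma left_ideal_colon (L : set A) x : left_ideal L -> left_ideal [set y | L (y * x)].
Proof.
move=> [L0 LD LM]; split=> [|y z|a y] /=; rewrite ?mul0r ?mulrDl -?mulrA //.
  exact: LD.
exact: LM.
Qed.

(** Right multiplication by [x] is a nonzero module map on the simple module
    [L], so its image is simple. *)
Lemma minimal_mulr (L : set A) x l : minimal_left_ideal L -> L l -> l * x <> 0 ->
  minimal_left_ideal [set l * x | l in L].
Proof.
move=> [hL L0 Lm] Ll lx0; split=> [||J hJ JL]; first exact: left_ideal_mulr.
  by move=> e; apply: lx0; move: (imageP ( *%R^~ x) Ll); rewrite e.
case: (Lm _ (left_ideal_cap hL (left_ideal_colon x hJ))) => [y []//|e|e].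
  left; apply/seteqP; split=> [j Jj|j ->]; last by case: hJ.
  have [y Ly yj] := JL _ Jj; subst j.
  have : (L `&` [set y | J (y * x)]) y by [].
  by rewrite e => ->; rewrite mul0r.
right; apply/seteqP; split=> // _ [y Ly <-].
by move: Ly; rewrite -e => -[].
Qed.

Lemma socle_two_sided : two_sided_ideal socle.
Proof.
have h0 : socle 0.
  by exists 0%N, (fun=> 0); split; [case | rewrite big_ord0].
have hD x y : socle x -> socle y -> socle (x + y).
  move=> [n [f [fP ->]]] [k [g [gP ->]]].
  exists (n + k)%N, (fun i : 'I_(n + k) =>
    match fintype.split i with inl j => f j | inr j => g j end).
  split=> [i|]; first by case: (fintype.split i).
  rewrite big_split_ord /=; congr (_ + _); apply: eq_bigr => i _.
    by rewrite (unsplitK (inl i)).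
  by rewrite (unsplitK (inr i)).
split; (split=> //; try exact: hD).
  move=> a x [n [f [fP ->]]]; exists n, (fun i => a * f i); split=> [i|].
    have [I mI If] := fP i; exists I => //.
    by case: mI => -[_ _ IM] _ _; apply: IM.
  by rewrite mulr_sumr.
move=> x a [n [f [fP ->]]]; exists n, (fun i => f i * a); split=> [i|].
  have [I mI If] := fP i; have [fa0|fa0] := pselect (f i * a = 0).
    by rewrite fa0; exists I => //; case: mI => -[].
  exists [set l * a | l in I]; first exact: minimal_mulr mI If fa0.
  exact: imageP.
by rewrite mulr_suml.
Qed.

Lemma annihilator_two_sided (L : set A) : left_ideal L -> two_sided_ideal (annihilator L).
Proof.
move=> [_ _ LM].
split; split=> [y _|x y hx hy z Lz|x y hy z Lz] /=; rewrite ?mul0r //.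
- by rewrite mulrDl hx ?hy ?addr0.
- by rewrite -mulrA hy ?mulr0.
- by rewrite mulrDl hx ?hy ?addr0.
- by rewrite -mulrA hy //; apply: LM.
Qed.

(** A two-sided ideal [I] not killing [L] contains every minimal left ideal
    [K] that does not kill [L]: right multiplication by some [x] in [L] maps [K]
    onto [L], so [I K] is nonzero, hence is [K].  The other minimal left ideals
    lie in the annihilator of [L]; as they span the ring together, [I] is
    everything as soon as it contains that annihilator. *)
Lemma annihilator_maximal (L : set A) : semisimple_ring A -> minimal_left_ideal L ->
  maximal_ideal (annihilator L).
Proof.
move=> ss mL; have [hL L0 Lm] := mL; have [LL0 LD LM] := hL.
split; first exact: annihilator_two_sided.
  move=> h; apply: L0; apply/seteqP; split=> x; last by move=> ->.
  by move=> /h; rewrite mul1r.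
move=> I hI sI nI1 x Ix y Ly; apply: contrapT => xy0; apply: nI1.
have [n [f [fP ->]]] := ss 1.
have [I0 ID IM] := two_sided_left hI.
apply: (big_ind I) => // i _; have [K mK Kf] := fP i.
have [hK K0 _] := mK.
have [nK|] := pselect (annihilator L (f i)); first exact: sI.
move=> /existsNP[z /not_implyP[Lz fz0]].
have eL : [set k * z | k in K] = L.
  apply: (minimal_eq mL (left_ideal_mulr z hK) _ (imageP _ Kf) fz0).
  by move=> _ [k _ <-]; apply: LM.
move: Ly; rewrite -eL => -[k Kk kz]; move: xy0; rewrite -kz mulrA => xkz0.
have [_ _ KM] := hK.
have e : I `&` K = K.
  apply: (minimal_eq (x := x * k) mK (left_ideal_cap (two_sided_left hI) hK)).
  - by move=> ? [].
  - by split; [apply: two_sidedMr | apply: KM].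
  - by move=> xk0; apply: xkz0; rewrite xk0 mul0r.
by move: Kf; rewrite -e => -[].
Qed.

(** Write [1] as a sum of elements of minimal left ideals; whatever annihilates
    all of these ideals annihilates [1]. *)
Lemma semisimple_maximal_ideals : semisimple_ring A ->
  exists ms : seq (set A), (forall m, m \in ms -> maximal_ideal m) /\
    (forall x, (forall m, m \in ms -> m x) -> x = 0).
Proof.
move=> ss; have [n [f [fP e1]]] := ss 1.
have hL i : exists L, minimal_left_ideal L /\ L (f i).
  by have [I mI If] := fP i; exists I.
have [L LP] := choice hL.
exists [seq annihilator (L i) | i <- enum 'I_n]; split.
  by move=> m /mapP[i _ ->]; apply: annihilator_maximal => //; case: (LP i).
move=> x xP; rewrite -[x]mulr1 e1 mulr_sumr big1 // => i _.
apply: (xP (annihilator (L i))); last by case: (LP i).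
by apply: map_f; rewrite mem_enum.
Qed.

(** Were the socle proper, it would lie in some [m] of [ms]; but a minimal left
    ideal inside the intersection of the other members of [ms] lies in the socle,
    hence in every member of [ms], and so vanishes. *)
Lemma artinian_semisimple (ms : seq (set A)) : left_artinian A ->
  (forall m, m \in ms -> maximal_ideal m) ->
  (forall x, (forall m, m \in ms -> m x) -> x = 0) -> semisimple_ring A.
Proof.
move=> la hms ms0; apply: contrapT => nss.
have [soc1|nsoc1] := pselect (socle 1).
  by apply: nss => x; apply: left_ideal_full (two_sided_left socle_two_sided) soc1.
have [m mms socm] := proper_sub_maximal hms ms0 socle_two_sided nsoc1.
pose N : set A := [set x | forall m', m' \in ms -> m' <> m -> m' x].
have mI m' : m' \in ms -> left_ideal m'.
  by move=> /hms[h _ _]; apply: two_sided_left.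
have hN : left_ideal N.
  split=> [m'|x y Nx Ny m'|a x Nx m'] m'ms nm; have [J0 JD JM] := mI _ m'ms => //.
    by apply: JD; [apply: Nx | apply: Ny].
  by apply: JM; apply: Nx.
have [_ m1 _] := hms _ mms.
have [e me eN] := comaximal_sep hms mms.
have [m0 _ _] := mI _ mms.
have [|L mL LN] := minimal_left_ideal_in la hN.
  move=> N0; have e0 : e = 0 by move: (eN : N e); rewrite N0.
  apply: m1; rewrite -[1]opprK; apply: left_idealN (mI _ mms) _.
  by move: me; rewrite e0 sub0r.
have [hL L0 _] := mL; apply: L0; apply/seteqP; split=> [x Lx|x ->]; last by case: hL.
apply: ms0 => m' m'ms; have [->|nm] := pselect (m' = m); last exact: LN.
apply: socm; exists 1%N, (fun=> x); split; first by exists L.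
by rewrite big_ord_recl big_ord0 addr0.
Qed.

(** Left ideals [J <= I] with the same image modulo every [m] in [ms] are equal,
    by Chinese remainders; so a chain of left ideals is stationary once
    all its images are. *)
Lemma left_artinian_mod (ms : seq (set A)) :
  (forall m, m \in ms -> maximal_ideal m) ->
  (forall x, (forall m, m \in ms -> m x) -> x = 0) ->
  (forall m, m \in ms -> exists (B : pzRingType) (g : {rmorphism A -> B}),
     [/\ left_artinian B, forall b, exists a, g a = b & forall x, g x = 0 -> m x]) ->
  left_artinian A.
Proof.
move=> hms ms0 H I hI dI.
have le i j : (i <= j)%N -> I j `<=` I i.
  by move=> /subnK <-; elim: (j - i)%N => // d IH x /dI; apply: IH.
suff [n nP] : exists n, forall m, m \in ms -> forall k, (n <= k)%N ->
    forall x, I n x -> exists2 y, I k y & m (x - y).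
  exists n => k nk; apply/seteqP; split=> [|x Ix]; first exact: le.
  have [|z Iz zP] := @crt_in _ ms (I k) (fun=> x) hms (hI k).
    by move=> m mms; apply: nP.
  by rewrite [x](_ : x = z) //; apply: subr0_eq; apply: ms0.
have {}H m : m \in ms -> exists n, forall k, (n <= k)%N ->
    forall x, I n x -> exists2 y, I k y & m (x - y).
  move=> /H[B [g [la gs gm]]].
  have [n|n b [x Ix <-]|n nP] := la (fun n => g @` I n); first exact: image_left_ideal.
    by exists x => //; apply: dI.
  exists n => k /nP e x /(imageP g); rewrite -e => -[y Iy gy]; exists y => //.
  by apply: gm; rewrite rmorphB gy subrr.
elim: ms H {hms ms0} => [|m ms IH] H; first by exists 0%N.
have [|n nP] := IH; first by move=> m' h; apply: H; rewrite inE h orbT.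
have [|n' n'P] := H m; first by rewrite inE eqxx.
exists (maxn n n') => m' + k; rewrite geq_max => m'ms /andP[nk n'k] x Ix.
move: m'ms; rewrite inE => /predU1P[->|m'ms].
  by apply: n'P => //; apply: le Ix; apply: leq_maxr.
by apply: (nP m') => //; apply: le Ix; apply: leq_maxl.
Qed.


End Semisimple.

(** * Recognising left localizations *)

(** The three properties determine [f] up to a unique isomorphism under [R], and
    hold for the map [R -> S^-1 R] as well as for its composites with surjections
    to direct factors. *)
Definition is_localization (R A : pzRingType) (f : {rmorphism R -> A}) (S : set R) :=
  [/\ forall s, S s -> invertible (f s),
      forall q, exists2 s, S s & exists r, f s * q = f r
    & forall r, f r = 0 -> ass S r].

Lemma loc_in_localization (R : pzRingType) (S : set R) (hS : left_denominator S) :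
  is_localization (loc_in hS) S.
Proof.
split=> [s Ss|q|r /loc_in_eq0 //].
  by exists (Defs.frac hS Ss 1); apply: frac_inv.
have [s [Ss [r ->]]] := frac_surj q; exists s => //; exists r.
by rewrite fracE mulrA (frac_inv hS Ss).2 mul1r.
Qed.

Lemma unit_preim_multiplicative (R A : pzRingType) (f : {rmorphism R -> A}) :
  (1 : A) <> 0 -> Defs.multiplicative (f @^-1` (@invertible A)).
Proof.
move=> A1; split=> [|s t hs ht|[y [y0 _]]] /=.
- by rewrite rmorph1; apply: invertible1.
- by rewrite rmorphM; apply: invertibleM.
- by apply: A1; rewrite -y0 rmorph0 mulr0.
Qed.

Section IsLocalization.
Variables (R A : pzRingType) (f : {rmorphism R -> A}) (S : set R).
Hypothesis fS : is_localization f S.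

Lemma localization_ker r : f r = 0 <-> ass S r.
Proof.
have [fi _ fk] := fS; split; first exact: fk.
by move=> [s /fi si sr]; apply: (invertible_eq0 si); rewrite -rmorphM sr rmorph0.
Qed.

Lemma localization_ore (r : R) q : invertible q ->
  exists2 t, S t & exists u, f t * f r = f u * q.
Proof.
have [fi ff _] := fS.
move=> [s' [s's _]]; have [t St [u e]] := ff (f r * s').
by exists t => //; exists u; rewrite -e -!mulrA s's mulr1.
Qed.

Lemma localization_left_denominator : Defs.multiplicative S -> left_denominator S.
Proof.
have [fi _ fk] := fS; move=> mS; have [S1 SM S0] := mS.
split; first split=> // [r s Ss].
  have [t St [u e]] := localization_ore r (fi _ Ss).
  have [|v Sv] := fk (t * r - u * s); first by rewrite rmorphB !rmorphM e subrr.
  rewrite mulrBr => /subr0_eq; rewrite !mulrA => e'.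
  by exists (v * t); [apply: SM | exists (v * u)].
move=> r s Ss rs; apply: fk; apply: (invertible_left_regular (fi _ Ss)).
by rewrite -rmorphM rs rmorph0.
Qed.

Lemma localization_universal (B : pzRingType) (h : {rmorphism R -> B}) :
  (forall s, S s -> invertible (h s)) ->
  exists g : {rmorphism A -> B}, forall r, g (f r) = h r.
Proof.
move=> hi; have [fi ff fk] := fS.
have hk r : f r = 0 -> h r = 0.
  move=> /fk[s Ss sr]; apply: (invertible_eq0 (hi _ Ss)).
  by rewrite -rmorphM sr rmorph0.
(* The graph of the map [s^-1 r |-> (h s)^-1 (h r)]. *)
pose G q b := exists s r,
  [/\ invertible (f s), invertible (h s), f s * q = f r & h s * b = h r].
have GB q q' b b' : G q b -> G q' b' -> G (q - q') (b - b').
  move=> [s [r [fs hs e1 e2]]] [s' [r' [fs' hs' e1' e2']]].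
  have [t St [u e]] := localization_ore s fs'.
  have he : h t * h s = h u * h s'.
    apply: subr0_eq; rewrite -!rmorphM -rmorphB; apply: hk.
    by rewrite rmorphB !rmorphM e subrr.
  exists (t * s), (t * r - u * r'); rewrite !rmorphB !rmorphM; split.
  - by apply: invertibleM => //; apply: fi.
  - by apply: invertibleM => //; apply: hi.
  - by rewrite mulrBr -!mulrA e1 mulrA e -mulrA e1'.
  - by rewrite mulrBr -!mulrA e2 mulrA he -mulrA e2'.
have GM q q' b b' : G q b -> G q' b' -> G (q * q') (b * b').
  move=> [s [r [fs hs e1 e2]]] [s' [r' [fs' hs' e1' e2']]].
  have [t St [u e]] := localization_ore r fs'.
  have he : h t * h r = h u * h s'.
    apply: subr0_eq; rewrite -!rmorphM -rmorphB; apply: hk.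
    by rewrite rmorphB !rmorphM e subrr.
  exists (t * s), (u * r'); rewrite !rmorphM; split.
  - by apply: invertibleM => //; apply: fi.
  - by apply: invertibleM => //; apply: hi.
  - by rewrite mulrA -(mulrA (f t)) e1 e -!mulrA e1'.
  - by rewrite mulrA -(mulrA (h t)) e2 he -!mulrA e2'.
have G0 b : G 0 b -> b = 0.
  move=> [s [r [_ hs e1 e2]]]; apply: (invertible_eq0 hs); rewrite e2.
  by apply: hk; rewrite -e1 mulr0.
have Gu q b b' : G q b -> G q b' -> b = b'.
  by move=> h1 h2; apply: subr0_eq; apply: G0; rewrite -(subrr q); apply: GB.
have Gf r : G (f r) (h r).
  by exists 1, r; rewrite !rmorph1 !mul1r; split=> //; apply: invertible1.
have Gex q : exists b, G q b.
  have [s Ss [r e]] := ff q; have [s' [s's ss']] := hi _ Ss.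
  exists (s' * h r), s, r; split=> //; [exact: fi|exact: hi|].
  by rewrite mulrA ss' mul1r.
have [g gP] := choice Gex.
have [||g' g'E] := @exists_rmorphism _ _ g.
- by move=> x y; apply: Gu (gP _) _; apply: GB.
- split=> [|x y]; last by apply: Gu (gP _) _; apply: GM.
  by apply: Gu (gP _) _; rewrite -(rmorph1 f) -(rmorph1 h).
by exists g' => r; rewrite g'E; apply: Gu (gP _) _.
Qed.

Lemma localization_unit_preim : is_localization f (f @^-1` (@invertible A)).
Proof.
have [fi ff fk] := fS; split=> // [q|r /fk [s Ss sr]].
  by have [s Ss e] := ff q; exists s => //; apply: fi.
by exists s => //; apply: fi.
Qed.

Definition extension (J : set R) : set A :=
  [set q | exists2 s, S s & exists2 x, J x & f s * q = f x].

(** The extension [L] of [J] satisfies [L f(s) <= L] for each denominator [s]; in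
    the artinian case this forces [L f(s)^-1 <= L]. *)
Lemma extension_two_sided (J : set R) : Defs.multiplicative S -> left_artinian A ->
  two_sided_ideal J -> two_sided_ideal (extension J).
Proof.
move=> [S1 SM _] la hJ; have [fi ff fk] := fS.
have [[J0 JD JM] [_ _ JMr]] := hJ.
have hL : left_ideal (extension J).
  split=> [|q q' [s Ss [x Jx e]] [s' Ss' [x' Jx' e']]|a q [s Ss [x Jx e]]].
  - by exists 1 => //; exists 0 => //; rewrite mulr0 rmorph0.
  - have [t St [u eu]] := localization_ore s (fi _ Ss').
    exists (t * s); first exact: SM.
    exists (t * x + u * x'); first by apply: JD; apply: JM.
    rewrite rmorphD !rmorphM mulrDr -!mulrA e; congr (_ + _).
    by rewrite mulrA eu -mulrA e'.
  - have [b [bs sb]] := fi _ Ss; have [t St [u eu]] := ff (a * b).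
    exists t => //; exists (u * x); first exact: JM.
    by rewrite rmorphM -eu -e -!mulrA (mulrA b) bs mul1r.
have Lr q r : extension J q -> extension J (q * f r).
  move=> [s Ss [x Jx e]]; exists s => //; exists (x * r); first exact: JMr.
  by rewrite mulrA e rmorphM.
split=> //; have [L0 LD _] := hL; split=> // q a Lq.
have [s Ss [r e]] := ff a; have [b [bs sb]] := fi _ Ss.
have -> : q * a = q * b * f r by rewrite -e -!mulrA (mulrA b) bs mul1r.
apply: (Lr); apply: (artinian_ideal_divr la hL (fi _ Ss)) => [x|]; first exact: Lr.
by rewrite -mulrA bs mulr1.
Qed.

Lemma extension_full (J : set R) : Defs.multiplicative S -> two_sided_ideal J ->
  extension J 1 -> exists2 x, S x & J x.
Proof.
move=> [_ SM _] hJ [s Ss [x Jx]]; rewrite mulr1 => e; have [_ _ fk] := fS.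
have [|t St] := fk (s - x); first by rewrite rmorphB e subrr.
rewrite mulrBr => /subr0_eq ts; exists (t * s); first exact: SM.
by rewrite ts; apply: two_sidedMl.
Qed.

(** A direct factor [B] of [A], cut out by an element [e] acting as the identity
    of [B]: its denominators are the elements that become units in [B]. *)
Lemma localization_factor (B : pzRingType) (g : {rmorphism A -> B}) e :
  (forall b, exists a, g a = b) -> g e = 1 -> (forall x, g x = 0 -> e * x = 0) ->
  is_localization (g \o f) ((g \o f) @^-1` (@invertible B)).
Proof.
move=> gs ge1 ke; have [fi ff fk] := fS.
have Si s : S s -> invertible (g (f s)) by move=> /fi /(@invertible_rmorph _ _ g).
split=> [//|b|r /= /ke er].
  have [a <-] := gs b; have [s Ss [r e']] := ff a.
  exists s; first exact: Si.
  by exists r; rewrite /= -e' rmorphM.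
have [s Ss [x ex]] := ff e.
have [|t St txr] := fk (x * r); first by rewrite rmorphM -ex -mulrA er mulr0.
exists (t * x); last by rewrite -mulrA.
by rewrite /= !rmorphM -ex rmorphM ge1 mulr1; apply: invertibleM; apply: Si.
Qed.

End IsLocalization.

Lemma inj_surj_bijective (A B : Type) (g : A -> B) : injective g ->
  (forall b, exists a, g a = b) -> bijective g.
Proof.
move=> gi gs; have [h hK] := choice gs; exists h => // x; exact: gi.
Qed.

Lemma rmorph_inj (A B : pzRingType) (g : {rmorphism A -> B}) :
  (forall x, g x = 0 -> x = 0) -> injective g.
Proof.
by move=> gk x y e; apply: subr0_eq; apply: gk; rewrite rmorphB e subrr.
Qed.

(** The universal property of [f] gives the map; it is injective as [f] and [h]
    have the same kernel [ass S]. *)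
Lemma localization_iso (R A B : pzRingType) (f : {rmorphism R -> A})
    (h : {rmorphism R -> B}) (S : set R) :
  is_localization f S -> is_localization h S ->
  exists2 g : {rmorphism A -> B}, bijective g & forall r, g (f r) = h r.
Proof.
move=> fS hS; have [hi hf hk] := hS; have [fi ff _] := fS.
have [g gf] := localization_universal fS hi; exists g => //.
apply: inj_surj_bijective => [|b].
  apply: rmorph_inj => q gq0; have [s Ss [r e]] := ff q.
  apply: (invertible_eq0 (fi _ Ss)); rewrite e; apply/(localization_ker fS)/hk.
  by rewrite -gf -e rmorphM gq0 mulr0.
have [s Ss [r e]] := hf b; have [s' [s's ss']] := fi _ Ss.
exists (s' * f r); apply: (invertible_inj (hi _ Ss)).
by rewrite e -!gf -rmorphM mulrA ss' mul1r.
Qed.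

Lemma ring_iso_sym (A B : pzRingType) : ring_iso A B -> ring_iso B A.
Proof.
move=> [f [g fK gK]]; have [||h hE] := @exists_rmorphism _ _ g.
- by move=> x y; apply: (can_inj fK); rewrite rmorphB !gK.
- by split=> [|x y]; apply: (can_inj fK); rewrite ?rmorph1 ?rmorphM !gK.
by exists h, f => x; rewrite hE.
Qed.

Lemma ring_iso_trans (A B D : pzRingType) :
  ring_iso A B -> ring_iso B D -> ring_iso A D.
Proof. by move=> [f fb] [g gb]; exists (g \o f); apply: bij_comp. Qed.

Lemma semisimple_artinian_iso (A B : pzRingType) :
  ring_iso A B -> semisimple_artinian A -> semisimple_artinian B.
Proof.
move=> [g gb] [ss art]; have [g' gK g'K] := gb.
have gs b : exists a, g a = b by exists (g' b).
split; last exact: artinian_surj gs art.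
move=> b; have [n [f [fP e]]] := ss (g' b); exists n, (g \o f); split=> [i|]; last first.
  by rewrite -[b]g'K e rmorph_sum.
have [I [hI I0 Im] If] := fP i.
have pK (X : set B) : g @` (g @^-1` X) = X.
  by apply: image_preimage; apply/seteqP; split=> // y _; exists (g' y).
exists (g @` I); last exact: imageP.
split; first exact: image_left_ideal.
- move=> e0; apply: I0; apply/seteqP; split=> [x Ix|x ->]; last by case: hI.
  by move: (imageP g Ix); rewrite e0 -(rmorph0 g) => /(can_inj gK).
move=> J hJ JI; case: (Im _ (preim_left_ideal g hJ)) => [x /= /JI [y Iy]|e0|e0].
- by move=> /(can_inj gK) <-.
- by left; rewrite -(pK J) e0 image_set1 rmorph0.
- by right; rewrite -(pK J) e0.
Qed.

(** * Products *)

(** The converse ring turns right ideals into left ideals, so that the chain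
    condition on products needs one proof only. *)
Section Converse.
Variable R : pzRingType.
Local Notation Rc := (R^c : pzRingType).

Lemma left_ideal_converse (I : set R) : @left_ideal Rc I <-> right_ideal I.
Proof.
by split=> -[h1 h2 h3]; split; first [exact: h1 | exact: h2 | move=> a x Ix; exact: h3].
Qed.

Lemma right_ideal_converse (I : set R) : @right_ideal Rc I <-> left_ideal I.
Proof.
by split=> -[h1 h2 h3]; split; first [exact: h1 | exact: h2 | move=> a x Ix; exact: h3].
Qed.

Lemma two_sided_converse (I : set R) : @two_sided_ideal Rc I <-> two_sided_ideal I.
Proof.
split=> -[hl hr]; split.
- exact: (right_ideal_converse I).1 hr.
- exact: (left_ideal_converse I).1 hl.
- exact: (left_ideal_converse I).2 hr.
- exact: (right_ideal_converse I).2 hl.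
Qed.

Lemma maximal_ideal_converse (m : set R) : maximal_ideal m -> @maximal_ideal Rc m.
Proof.
move=> [hm m1 mmax]; split=> //; first exact: (two_sided_converse m).2.
by move=> J /(two_sided_converse J).1; apply: mmax.
Qed.

Lemma right_artinian_converse : right_artinian R <-> left_artinian Rc.
Proof.
split=> h I hI; apply: (h I) => n; first exact: (left_ideal_converse (I n)).1.
exact: (left_ideal_converse (I n)).2.
Qed.

Lemma rmorph_converse (B : pzRingType) (g : {rmorphism R -> B}) :
  exists h : {rmorphism Rc -> (B^c : pzRingType)}, h =1 g.
Proof.
apply: exists_rmorphism => [x y|]; first exact: (rmorphB g).
by split=> [|x y]; [exact: (rmorph1 g) | exact: (rmorphM g)].
Qed.

End Converse.

Lemma right_artinian_mod (R : pzRingType) (ms : seq (set R)) :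
  (forall m, m \in ms -> maximal_ideal m) ->
  (forall x, (forall m, m \in ms -> m x) -> x = 0) ->
  (forall m, m \in ms -> exists (B : pzRingType) (g : {rmorphism R -> B}),
     [/\ right_artinian B, forall b, exists a, g a = b & forall x, g x = 0 -> m x]) ->
  right_artinian R.
Proof.
move=> hms ms0 H; apply: (right_artinian_converse R).2.
apply: (@left_artinian_mod (R^c : pzRingType) ms _ ms0).
  by move=> m /hms; apply: maximal_ideal_converse.
move=> m /H[B [g [la gs gm]]]; have [p pE] := rmorph_converse g.
exists (B^c : pzRingType), p; split.
- exact: (right_artinian_converse B).1 la.
- by move=> b; have [x xb] := gs b; exists x; rewrite pE.
- by move=> x; rewrite pE; apply: gm.
Qed.

Definition prod_proj (I : Type) (A : I -> pzRingType) (i : I) (x : prod_ring A) : A i :=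
  x i.

Section Product.
Variables (I : Type) (A : I -> pzRingType).

Fact prod_proj_zmod (i : I) : zmod_morphism (@prod_proj I A i).
Proof. by []. Qed.
Fact prod_proj_monoid (i : I) : monoid_morphism (@prod_proj I A i).
Proof. by []. Qed.
HB.instance Definition _ (i : I) :=
  GRing.isZmodMorphism.Build (prod_ring A) (A i) (@prod_proj I A i) (prod_proj_zmod i).
HB.instance Definition _ (i : I) :=
  GRing.isMonoidMorphism.Build (prod_ring A) (A i) (@prod_proj I A i) (prod_proj_monoid i).

Lemma prod_ext (x y : prod_ring A) : (forall i, prod_proj i x = prod_proj i y) -> x = y.
Proof. by move=> h; apply: functional_extensionality_dep => i; apply: h. Qed.

(** The transport [eq_rect] lets one family carry [a] at [i] and [0] elsewhere
    although the types [A j] vary. *)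
Lemma prod_proj_surj i (a : A i) : exists x : prod_ring A, prod_proj i x = a.
Proof.
have h j : exists b : A j, forall e : i = j, b = eq_rect i A a j e.
  have [e|ne] := pselect (i = j); last by exists 0 => e; case: ne.
  by subst j; exists a => e; rewrite (Prop_irrelevance e erefl).
exists (fun j => projT1 (cid (h j))); rewrite /prod_proj.
by case: (cid (h i)) => b /= /(_ erefl).
Qed.

Lemma prod_invertible (x : prod_ring A) :
  (forall i, invertible (prod_proj i x)) -> invertible x.
Proof.
move=> h; pose y : prod_ring A := fun i => projT1 (cid (h i)).
have yP i : prod_proj i y * prod_proj i x = 1 /\ prod_proj i x * prod_proj i y = 1.
  exact: projT2 (cid (h i)).
by exists y; split; apply: prod_ext => i; rewrite rmorphM rmorph1; case: (yP i).
Qed.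

Lemma rmorph_prod (Q : pzRingType) (g : forall i, {rmorphism Q -> A i}) :
  exists h : {rmorphism Q -> prod_ring A}, forall i q, prod_proj i (h q) = g i q.
Proof.
have [||h hE] := @exists_rmorphism Q (prod_ring A) (fun q i => g i q).
- by move=> x y; apply: prod_ext => i; rewrite rmorphB /prod_proj rmorphB.
- split=> [|x y]; apply: prod_ext => i; rewrite ?rmorph1 ?rmorphM /prod_proj.
    by rewrite rmorph1.
  by rewrite rmorphM.
by exists h => i q; rewrite hE.
Qed.

(** Chinese remainders, for rings [A i] that are only isomorphic to the quotients
    [Q / k i] through the surjections [g]. *)
Lemma ring_iso_prod (Q : pzRingType) (ms : seq (set Q)) (k : I -> set Q) :
  (forall m, m \in ms -> maximal_ideal m) ->
  (forall x, (forall m, m \in ms -> m x) -> x = 0) ->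
  injective k -> (forall i, k i \in ms) -> (forall m, m \in ms -> exists i, k i = m) ->
  (forall i, exists2 g : {rmorphism Q -> A i},
     forall a, exists q, g q = a & forall q, g q = 0 <-> k i q) ->
  ring_iso Q (prod_ring A).
Proof.
move=> hms ms0 kinj kms kall hg'.
have hg i := cid2 (hg' i).
pose g i := s2val (hg i).
have gs i : forall a, exists q, g i q = a := s2valP (hg i).
have gk i : forall q, g i q = 0 <-> k i q := s2valP' (hg i).
have [h hE] := rmorph_prod g; exists h; apply: inj_surj_bijective => [|a].
  apply: rmorph_inj => q q0; apply: ms0 => m /kall[i <-].
  by apply/(gk i); rewrite -hE q0 rmorph0.
have ex m : exists x, forall i, k i = m -> g i x = prod_proj i a.
  have [[i ki]|nk] := pselect (exists i, k i = m); last first.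
    by exists 0 => i ki; case: nk; exists i.
  have [x xa] := gs i (prod_proj i a); exists x => j.
  by rewrite -ki => /kinj ->.
have [x xP] := choice ex.
have [||q _ qP] := @crt_in _ ms setT x hms; first by split.
  by move=> m mms; exists (x m) => //; rewrite subrr; case: (hms _ mms) => -[[]].
exists q; apply: prod_ext => i; rewrite (hE i) -(xP _ i erefl).
by apply/esym/subr0_eq; rewrite -rmorphB; apply/(gk i); exact: qP (kms i).
Qed.

End Product.

(** The kernels of the projections are finitely many maximal ideals with zero
    intersection, and the quotients by them are artinian. *)
Lemma prod_semisimple_artinian (T : eqType) (M : set T) (A : {x | M x} -> pzRingType) :
  finite_set M -> (forall i, simple_artinian (A i)) -> semisimple_artinian (prod_ring A).
Proof.
move=> /finite_seqP[l Ml] sA.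
pose K (i : {x | M x}) : set (prod_ring A) := (@prod_proj _ A i : _ -> _) @^-1` [set 0].
have Kmax i : maximal_ideal (K i).
  apply: (simple_ker_maximal (g := @prod_proj _ A i)); first exact: prod_proj_surj.
  by case: (sA i).
have [ms msP] : exists ms : seq (set (prod_ring A)),
    forall m, m \in ms <-> exists i, m = K i.
  have [k kP] : {k : T -> set (prod_ring A) &
      forall x (h : M x), k x = K (exist _ x h)}.
    apply: (@choice _ _ (fun x m => forall h : M x, m = K (exist _ x h))) => x.
    have [h|nh] := pselect (M x); last by exists setT.
    by exists (K (exist _ x h)) => h'; rewrite (Prop_irrelevance h h').
  exists (map k l) => m; split=> [/mapP[x xl ->]|[[x h] ->]].
    have h : M x by rewrite Ml.
    by exists (exist _ x h); apply: kP.
  by rewrite -kP; apply: map_f; move: h; rewrite Ml.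
have hms m : m \in ms -> maximal_ideal m by move=> /msP[i ->].
have ms0 x : (forall m, m \in ms -> m x) -> x = 0.
  move=> h; apply: prod_ext => i; rewrite rmorph0.
  by apply: (h (K i)); apply/msP; exists i.
have la : left_artinian (prod_ring A).
  apply: (left_artinian_mod hms ms0) => m /msP[i ->].
  exists (A i), (@prod_proj _ A i); split=> //; last exact: prod_proj_surj.
  by case: (sA i) => _ [].
have ra : right_artinian (prod_ring A).
  apply: (right_artinian_mod hms ms0) => m /msP[i ->].
  exists (A i), (@prod_proj _ A i); split=> //; last exact: prod_proj_surj.
  by case: (sA i) => _ [].
split; last by [].
exact: artinian_semisimple la hms ms0.
Qed.

(** * Maximal denominator sets and maximal ideals *)

Lemma ass_two_sided (R : pzRingType) (S : set R) :
  left_denominator S -> two_sided_ideal (ass S).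
Proof.
move=> hS; have -> : ass S = loc_in hS @^-1` [set 0].
  by apply/seteqP; split=> r; move/(loc_in_eq0 hS r).
exact: preim_two_sided (two_sided0 _).
Qed.

Section UnitMod.
Variable Q : pzRingType.
Implicit Types m : set Q.

Definition unit_mod (m : set Q) : set Q :=
  [set q | exists u, m (u * q - 1) /\ m (q * u - 1)].

Lemma unit_modP m (hm : two_sided_ideal m) q :
  unit_mod m q <-> invertible (quot_pi hm q).
Proof.
split=> [[u [m1 m2]]|[y]].
  exists (quot_pi hm u); split; rewrite -rmorphM -(rmorph1 (quot_pi hm)).
    by apply/quot_piP.
  by apply/quot_piP.
have [u ->] := quot_pi_surj y; rewrite -!rmorphM -(rmorph1 (quot_pi hm)).
by move=> [/quot_piP m1 /quot_piP m2]; exists u.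
Qed.

Lemma quot_pi_eq0 m (hm : two_sided_ideal m) q : quot_pi hm q = 0 <-> m q.
Proof. by rewrite -(rmorph0 (quot_pi hm)) quot_piP subr0. Qed.

Lemma quot_pi_onto m (hm : two_sided_ideal m) b : exists q, quot_pi hm q = b.
Proof. by have [q ->] := quot_pi_surj b; exists q. Qed.

End UnitMod.

Section Denominators.
Variables (R Q : pzRingType) (f : {rmorphism R -> Q}) (C : set R) (ms : seq (set Q)).
Hypotheses (mC : Defs.multiplicative C) (fC : is_localization f C).
Hypotheses (Creg : C `<=` left_regular R) (Qart : artinian Q).
Hypothesis hms : forall m, m \in ms -> maximal_ideal m.
Hypothesis ms0 : forall x, (forall m, m \in ms -> m x) -> x = 0.

Definition denominators_at (m : set Q) : set R := f @^-1` unit_mod m.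

Lemma denominators_atE m (hm : two_sided_ideal m) :
  denominators_at m = (quot_pi hm \o f) @^-1` (@invertible _).
Proof.
apply/seteqP; split=> r; first exact: (unit_modP hm (f r)).1.
exact: (unit_modP hm (f r)).2.
Qed.

Lemma denominators_at_localization m (hm : two_sided_ideal m) : m \in ms ->
  is_localization (quot_pi hm \o f) (denominators_at m).
Proof.
move=> mms; have [e me eP] := comaximal_sep hms mms.
rewrite (denominators_atE hm).
apply: (localization_factor fC (e := e)) => [||x /quot_pi_eq0 mx].
- exact: quot_pi_onto.
- by rewrite -(rmorph1 (quot_pi hm)); apply/quot_piP.
apply: ms0 => m' m'ms; have [hm' _ _] := hms m'ms.
have [->|nm] := pselect (m' = m); first exact: two_sidedMl.
by apply: two_sidedMr => //; apply: eP.
Qed.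

Lemma denominators_at_den m : m \in ms -> left_denominator (denominators_at m).
Proof.
move=> mms; have [hm m1 _] := hms mms.
apply: (localization_left_denominator (denominators_at_localization hm mms)).
rewrite (denominators_atE hm).
apply: unit_preim_multiplicative => /esym e; apply: m1; apply/(quot_pi_eq0 hm).
by rewrite rmorph1.
Qed.

Lemma ass_denominators_at m : m \in ms -> ass (denominators_at m) = f @^-1` m.
Proof.
move=> mms; have [hm _ _] := hms mms.
have hl := denominators_at_localization hm mms.
apply/seteqP; split=> r.
  by move/(localization_ker hl r) => /quot_pi_eq0.
by move=> /= mr; apply/(localization_ker hl)/quot_pi_eq0.
Qed.

Lemma sub_denominators_at m : m \in ms -> C `<=` denominators_at m.
Proof.
move=> mms c Cc; have [hm _ _] := hms mms; have [fi _ _] := fC.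
by apply/(unit_modP hm)/invertible_rmorph/fi.
Qed.

(** The idempotent [e] that is [1] modulo [m] and [0] modulo the other ideals is
    a fraction [(f c)^-1 (f r)]; then [r] is a denominator at [m] only. *)
Lemma denominators_at_inj m m' : m \in ms -> m' \in ms ->
  denominators_at m `<=` denominators_at m' -> m' = m.
Proof.
move=> mms m'ms sub; apply: contrapT => nm.
have [hm _ _] := hms mms; have [hm' m'1 _] := hms m'ms; have [fi ff _] := fC.
have [e me eP] := comaximal_sep hms mms.
have [c Cc [r er]] := ff e.
have [|u [m1 _]] := sub r.
  apply/(unit_modP hm); rewrite -er.
  have -> : quot_pi hm (f c * e) = quot_pi hm (f c).
    by apply/quot_piP; rewrite -{2}[f c]mulr1 -mulrBr; apply: two_sidedMl.
  exact/(invertible_rmorph (quot_pi hm))/fi.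
apply: m'1; rewrite -(subKr (u * f r) 1).
have hl := two_sided_left hm'; apply: left_idealB => //.
by rewrite -er; do 2! apply: two_sidedMl => //; apply: eP.
Qed.

(** The ideal [P] of [Q] extended from [ass T] is proper, as the elements of [C]
    are not killed by those of [T].  The elements of [T] are left regular modulo
    [P] by the left denominator property, hence units in the artinian ring
    [Q / P], and a fortiori modulo any maximal ideal over [P]. *)
Lemma left_denominator_sub T : left_denominator T ->
  exists2 m, m \in ms & T `<=` denominators_at m.
Proof.
move=> hT; have [[[T1 TM T0] _] Tden] := hT; have [C1 CM C0] := mC.
have [fi ff fk] := fC; have hJ := ass_two_sided hT.
have hP := extension_two_sided fC mC (proj1 Qart) hJ.
set P := extension f C (ass T) in hP.
have P1 : ~ P 1.
  move=> /(extension_full fC mC hJ)[x /Creg xreg [t Tt tx]]; apply: T0.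
  by rewrite -(xreg _ tx).
have [m mms Pm] := proper_sub_maximal hms ms0 hP P1.
exists m => // t Tt.
have [[P0 PD PM] _] := hP.
have Pt q : P (q * f t) -> P q.
  move=> Pqt; have [d Cd [r er]] := ff q.
  have [c Cc [x Jx]] : P (f d * (q * f t)) by apply: PM.
  rewrite (mulrA (f d)) er -!rmorphM => ex.
  have [|c' Cc'] := fk (c * (r * t) - x); first by rewrite rmorphB ex subrr.
  rewrite mulrBr => /subr0_eq ecx.
  have [t' Tt'] : ass T (c' * (c * (r * t))) by rewrite ecx; apply: two_sidedMl.
  move=> e0; have [|t'' Tt'' e1] := Tden (t' * (c' * (c * r))) t Tt.
    by rewrite -e0 !mulrA.
  have Jr : ass T (c' * (c * r)).
    by exists (t'' * t'); [apply: TM | rewrite -mulrA].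
  have [d' [d'd _]] := fi _ Cd; rewrite -[q]mul1r -d'd -mulrA er; apply: PM.
  exists (c' * c); first exact: CM.
  by exists (c' * (c * r)); rewrite ?mulrA -?rmorphM ?mulrA // -!mulrA.
have := artinian_surj (@quot_pi_onto _ _ hP) Qart => -[la _].
have [|y] := artinian_left_regular la (x := quot_pi hP (f t)).
  move=> y; have [q ->] := quot_pi_surj y; rewrite -rmorphM => /quot_pi_eq0 /Pt Pq.
  exact/quot_pi_eq0.
have [u ->] := quot_pi_surj y; rewrite -!rmorphM -(rmorph1 (quot_pi hP)).
by move=> [/quot_piP m1 /quot_piP m2]; exists u; split; apply: Pm.
Qed.

(** Each left denominator set lies in some [denominators_at m], and these are
    pairwise incomparable. *)
Lemma max_denP T : max_den R T <-> exists2 m, m \in ms & T = denominators_at m.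
Proof.
split=> [[hT Tmax]|[m mms ->]].
  have [m mms sT] := left_denominator_sub hT; exists m => //.
  by apply/esym/Tmax => //; apply: denominators_at_den.
split=> [|T' hT' sT']; first exact: denominators_at_den.
have [m' m'ms sT] := left_denominator_sub hT'.
have e : m' = m by apply: denominators_at_inj => // r /sT' /sT.
by apply/seteqP; split=> //; rewrite -e.
Qed.

Lemma loc_denominators_at T (hT : left_denominator T) m : m \in ms ->
  T = denominators_at m ->
  exists2 g : {rmorphism Q -> loc hT},
    forall a, exists q, g q = a & forall q, g q = 0 <-> m q.
Proof.
move=> mms eT; have [hm _ _] := hms mms.
have hl := denominators_at_localization hm mms; rewrite -eT in hl.
have [h [h' hK h'K] _] := localization_iso hl (loc_in_localization hT).
exists (h \o quot_pi hm) => [a|q] /=.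
  by have [q qa] := quot_pi_onto (h' a); exists q; rewrite /= qa h'K.
split=> [e|/quot_pi_eq0 ->]; last by rewrite rmorph0.
by apply/(quot_pi_eq0 hm)/(can_inj hK); rewrite e rmorph0.
Qed.

Lemma loc_simple_artinian T (hT : left_denominator T) m : m \in ms ->
  T = denominators_at m -> simple_artinian (loc hT).
Proof.
move=> mms eT; have [g gs gk] := loc_denominators_at hT mms eT.
split; last exact: artinian_surj gs Qart.
apply: (simple_surj gs); have -> : g @^-1` [set 0] = m; last exact: hms.
by apply/seteqP; split=> q /gk.
Qed.

(** The indexing [D] of the maximal left denominator sets is arbitrary, as sets
    of a quotient of [R] will be indexed by sets of [R]. *)
Lemma ring_iso_prod_loc (I : Type) (D : I -> set R)
    (hD : forall i, left_denominator (D i)) :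
  injective D -> (forall T, (exists i, D i = T) <-> max_den R T) ->
  ring_iso Q (prod_ring (fun i => loc (hD i))).
Proof.
move=> Dinj Dmax.
have ex i : exists m, m \in ms /\ D i = denominators_at m.
  have /Dmax/max_denP[m mms e] : exists j, D j = D i by exists i.
  by exists m.
have [k kP] := choice ex.
apply: (ring_iso_prod hms ms0 (k := k)) => [i j e|i|m mms|i].
- by apply: Dinj; rewrite (kP i).2 (kP j).2 e.
- by case: (kP i).
- have /Dmax[i Di] : max_den R (denominators_at m) by apply/max_denP; exists m.
  exists i; have [kms e] := kP i; apply/esym.
  by apply: denominators_at_inj => //; rewrite -e Di.
- by have [kms e] := kP i; apply: loc_denominators_at.
Qed.

End Denominators.

(** * The quotient by the torsion ideal *)

Section TorsionQuotient.
Variables (R Q : pzRingType) (f : {rmorphism R -> Q}) (C : set R).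
Hypotheses (mC : Defs.multiplicative C) (fC : is_localization f C).
Variable ha : two_sided_ideal (ass C).

Local Notation Rbar := (quot_ring ha : pzRingType).
Local Notation pi := (quot_pi ha).

Lemma quot_universal :
  exists g : {rmorphism Rbar -> Q}, forall r, g (pi r) = f r.
Proof.
have [p pK] := choice (@quot_pi_onto _ _ ha).
have E r : f (p (pi r)) = f r.
  apply: subr0_eq; rewrite -rmorphB; apply/(localization_ker fC)/(quot_piP ha).
  exact: pK.
have [||g gE] := @exists_rmorphism Rbar Q (fun b => f (p b)).
- move=> x y; have [r <-] := quot_pi_onto x; have [s <-] := quot_pi_onto y.
  by rewrite -(rmorphB pi) !E rmorphB.
- split=> [|x y]; first by rewrite -(rmorph1 pi) E rmorph1.
  have [r <-] := quot_pi_onto x; have [s <-] := quot_pi_onto y.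
  by rewrite -(rmorphM pi) !E rmorphM.
by exists g => r; rewrite gE E.
Qed.

Variable g : {rmorphism Rbar -> Q}.
Hypothesis gE : forall r, g (pi r) = f r.

Lemma quot_map_eq0 x : g x = 0 -> x = 0.
Proof.
have [r <-] := quot_pi_onto x; rewrite gE => /(localization_ker fC).
by move/(quot_pi_eq0 ha).
Qed.

Lemma quot_localization : is_localization g (pi @` C).
Proof.
have [fi ff fk] := fC; split=> [_ [c Cc <-]|q|x /quot_map_eq0 ->].
- by rewrite gE; apply: fi.
- have [c Cc [r er]] := ff q; exists (pi c); first exact: imageP.
  by exists (pi r); rewrite !gE.
- by have [C1 _ _] := mC; exists (pi 1); [apply: imageP | rewrite mulr0].
Qed.

Lemma quot_multiplicative : Defs.multiplicative (pi @` C).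
Proof.
have [C1 CM C0] := mC; split.
- by exists 1; rewrite // rmorph1.
- move=> _ _ [c Cc <-] [d Cd <-]; exists (c * d); first exact: CM.
  exact: rmorphM.
- move=> [c Cc /(quot_pi_eq0 ha)[d Cd dc]]; apply: C0.
  by rewrite -dc; apply: CM.
Qed.

Lemma quot_regular : pi @` C `<=` regular Rbar.
Proof.
move=> c Cc; have [gi _ _] := quot_localization; have gc := gi _ Cc.
split=> x xc; apply: quot_map_eq0.
  by apply: (invertible_left_regular gc); rewrite -rmorphM xc rmorph0.
by apply: (invertible_eq0 gc); rewrite -rmorphM xc rmorph0.
Qed.

Hypothesis Qart : left_artinian Q.

Lemma quot_left_regular_invertible t : left_regular Rbar t -> invertible (g t).
Proof.
move=> rt; apply: (artinian_left_regular Qart) => q qt.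
have [gi gf _] := quot_localization; have [c Cc [r er]] := gf q.
apply: (invertible_eq0 (gi _ Cc)); rewrite er.
have -> : r = 0; last exact: rmorph0.
by apply: rt; apply: quot_map_eq0; rewrite rmorphM -er -mulrA qt mulr0.
Qed.

Lemma quot_regular_multiplicative : Defs.multiplicative (regular Rbar).
Proof.
split=> [|s t [s1 s2] [t1 t2]|[h _]].
- by split=> x; rewrite ?mulr1 ?mul1r.
- by split=> x; [rewrite mulrA => /t1 /s1 | rewrite -mulrA => /s2 /t2].
- have [C1 _ C0] := quot_multiplicative; apply: C0.
  by rewrite -(h 1) ?mulr0 // ; have [c Cc e] := C1; exists c.
Qed.

Lemma quot_regular_localization : is_localization g (regular Rbar).
Proof.
have [gi gf gk] := quot_localization; split=> [t [rt _]|q|x /gk [c Cc cx]].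
- exact: quot_left_regular_invertible.
- by have [c Cc er] := gf q; exists c => //; apply: quot_regular.
- by exists c => //; apply: quot_regular.
Qed.

(** A regular [t] has its inverse of the form [(g c)^-1 (g r)] in [Q], so [r t]
    is the image of a denominator. *)
Lemma quot_dense : dense (pi @` C) (regular Rbar).
Proof.
split; [exact: quot_multiplicative | exact: quot_regular_multiplicative
  | exact: quot_regular|].
move=> t [rt _]; have [y [yt _]] := quot_left_regular_invertible rt.
have [gi gf gk] := quot_localization; have [c Cc [r er]] := gf y.
exists r; have <- // : c = r * t.
apply: subr0_eq; apply: quot_map_eq0.
by rewrite rmorphB rmorphM -er -mulrA yt mulr1 subrr.
Qed.

End TorsionQuotient.

(** * From the localizations at maximal denominator sets to their product *)

Section MaximalDenominators.
Variable R : pzRingType.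
Implicit Types S : set R.

(** The extension of [J] to the simple ring [S^-1 R] is a nonzero ideal, hence
    everything. *)
Lemma simple_loc_meets S (hS : left_denominator S) J : simple_artinian (loc hS) ->
  two_sided_ideal J -> ~ (J `<=` ass S) -> exists2 x, S x & J x.
Proof.
move=> [[_ simp] [la _]] hJ nJ; have [[mS _] _] := hS; have [S1 _ _] := mS.
have lS := loc_in_localization hS.
have [E0|ET] := simp _ (extension_two_sided lS mS la hJ).
  exfalso; apply: nJ => x Jx; apply/(loc_in_eq0 hS).
  have : extension (loc_in hS) S J (loc_in hS x).
    by exists 1 => //; exists x; rewrite // rmorph1 mul1r.
  by rewrite E0.
by apply: (extension_full lS mS hJ); rewrite ET.
Qed.

(** The elements that become units in [S^-1 R] form a left denominator set
    containing [S]. *)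
Lemma max_den_saturated S (hS : left_denominator S) r :
  max_den R S -> invertible (loc_in hS r) -> S r.
Proof.
move=> [_ Smax] ir; have [[[S1 _ S0] _] _] := hS.
have lS := loc_in_localization hS; have [li _ _] := lS.
rewrite -(Smax (loc_in hS @^-1` (@invertible _))) //.
apply: (localization_left_denominator (localization_unit_preim lS)).
apply: unit_preim_multiplicative => l1.
have /(loc_in_eq0 hS)[s Ss] : loc_in hS 1 = 0 by rewrite rmorph1.
by rewrite mulr1 => s0; apply: S0; rewrite -s0.
Qed.

(** If [ass S] were strictly smaller than [ass S'], some [x] in [ass S'] would be
    a denominator of [S]; an element of [S'] killing [x] would then lie in
    [ass S], hence in [ass S'].  So the two ideals agree, and the elements of [S]
    are left regular, hence units, in the artinian ring [S'^-1 R]. *)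
Lemma max_den_ass_inj S S' (hS : left_denominator S) (hS' : left_denominator S') :
  max_den R S -> max_den R S' -> simple_artinian (loc hS) ->
  simple_artinian (loc hS') -> ass S `<=` ass S' -> S' = S.
Proof.
move=> mS mS' saS saS' sub.
have bus : ass S' `<=` ass S.
  apply: contrapT => nsub.
  have [x Sx [s' Ss' sx]] := simple_loc_meets saS (ass_two_sided hS') nsub.
  have [_ /(_ s' x Sx sx)/sub[t' St' ts']] := hS.
  by have [[[_ SM S0] _] _] := hS'; apply: S0; rewrite -ts'; apply: SM.
case: (mS) => _; apply=> [//|s Ss].
apply: (max_den_saturated (hS := hS') mS').
apply: artinian_left_regular => [|q qs]; first by case: saS' => _ [].
have lS' := loc_in_localization hS'; have [li lf _] := lS'.
have [t St [x ex]] := lf q; apply: (invertible_eq0 (li _ St)); rewrite ex.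
apply/(loc_in_eq0 hS')/sub/(loc_in_eq0 hS).
have [ki _ _] := loc_in_localization hS.
apply: (invertible_left_regular (ki _ Ss)); rewrite -rmorphM; apply/(loc_in_eq0 hS)/bus.
by apply/(loc_in_eq0 hS'); rewrite rmorphM -ex -mulrA qs mulr0.
Qed.

Variable M : set (set R).
Hypotheses (Mmax : M `<=` max_den R) (Mfin : finite_set M).
Hypothesis Mden : forall S, M S -> left_denominator S.
Hypothesis Msa : forall S (hS : M S), simple_artinian (loc (Mden hS)).

(** [S] meets each of the other ideals [ass S'] by incomparability; a product of
    elements of these intersections lies in all of them. *)
Lemma max_den_separated S : M S ->
  exists2 x, S x & forall S', M S' -> S' <> S -> ass S' x.
Proof.
move=> MS; have [[[S1 SM _] _] _] := Mden MS.
have [l Ml] := (finite_seqP M).1 Mfin.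
have [|I|x Sx xP] := @meets_bigcap _ S [seq ass S' | S' <- l & S' != S] S1.
- exact: SM.
- move=> /mapP[S']; rewrite mem_filter => /andP[/eqP nS S'l ->].
  have MS' : M S' by rewrite Ml.
  split; first exact/ass_two_sided/Mden.
  apply: (simple_loc_meets (Msa MS)); first exact/ass_two_sided/Mden.
  move=> sub; apply: nS.
  by apply/esym; apply: (max_den_ass_inj (Mmax MS') (Mmax MS) (Msa MS') (Msa MS)).
exists x => // S' MS' /eqP nS; apply: xP; apply: map_f.
by rewrite mem_filter nS; move: MS'; rewrite Ml.
Qed.

Local Notation A := (fun i : {S | M S} => loc (Mden (proj2_sig i))).

Variable f : {rmorphism R -> prod_ring A}.
Hypothesis fE : forall i r, prod_proj i (f r) = loc_in (Mden (proj2_sig i)) r.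

(** Common denominators for the components of [a], built one factor at a time:
    the separating element [x] of a factor adds that component without
    disturbing the others. *)
Lemma prod_common_denominator (a : prod_ring A) :
  exists s r, invertible (f s) /\ f s * a = f r.
Proof.
have [l Ml] := (finite_seqP M).1 Mfin.
have fDM i u x t : prod_proj i (f (u + x * t)) =
    prod_proj i (f u) + prod_proj i (f x) * prod_proj i (f t).
  by rewrite !(rmorphD, rmorphM).
have H (l' : seq (set R)) : (forall S, S \in l' -> M S) ->
    exists s r, forall i : {S | M S}, if sval i \in l'
      then invertible (prod_proj i (f s)) /\
           prod_proj i (f s) * prod_proj i a = prod_proj i (f r)
      else prod_proj i (f s) = 0 /\ prod_proj i (f r) = 0.
  elim: l' => [|S l' IH] sl; first by exists 0, 0 => i; rewrite !rmorph0.
  have [|s [r H]] := IH; first by move=> S' h; apply: sl; rewrite inE h orbT.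
  have MS : M S by apply: sl; rewrite inE eqxx.
  have [Sl|nSl] := boolP (S \in l').
    exists s, r => i; rewrite inE.
    have -> : (sval i == S) || (sval i \in l') = (sval i \in l'); last exact: H.
    by have [->|] := eqVneq (sval i) S.
  have [x Sx xP] := max_den_separated MS.
  pose i0 : {S | M S} := exist _ S MS.
  have [li lf _] := loc_in_localization (Mden (proj2_sig i0)).
  have [t St [v ev]] := lf (prod_proj i0 a).
  exists (s + x * t), (r + x * v) => i; have := H i; rewrite inE.
  have [e|ne] := eqVneq (sval i) S.
    have -> : i = i0.
      case: i e => S' h /= e; subst S'.
      by rewrite /i0 (Prop_irrelevance h MS).
    rewrite (negbTE nSl) => -[s0 r0].
    rewrite !fDM s0 r0 !add0r !fE; split.
      by apply: invertibleM; apply: li.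
    by rewrite -mulrA ev.
  have x0 : prod_proj i (f x) = 0.
    by rewrite fE; apply/loc_in_eq0; apply: xP; [case: i {ne} | apply/eqP].
  by rewrite !fDM x0 !mul0r !addr0.
have [|s [r sr]] := H l; first by move=> S Sl; rewrite Ml.
have Ml' S : M S -> S \in l by rewrite Ml.
have il (i : {S | M S}) : sval i \in l := Ml' _ (proj2_sig i).
exists s, r; split.
  by apply: prod_invertible => i; have := sr i; rewrite il => -[].
by apply: prod_ext => i; rewrite rmorphM; have := sr i; rewrite il => -[].
Qed.

End MaximalDenominators.

(** * Semisimplicity of the localization at the left regular elements *)

Section Necessity.
Variables (R : pzRingType) (hC : left_denominator (left_regular R)).
Hypothesis Qsa : semisimple_artinian (loc hC).

Local Notation C := (left_regular R).
Local Notation f := (loc_in hC).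

Lemma max_den_lregP (ms : seq (set (loc hC))) T :
  (forall m, m \in ms -> maximal_ideal m) ->
  (forall x, (forall m, m \in ms -> m x) -> x = 0) ->
  max_den_lreg R T <-> exists2 m, m \in ms & T = denominators_at f m.
Proof.
move=> hms ms0; have [[mC _] _] := hC; have fC := loc_in_localization hC.
have Creg : C `<=` C by [].
have mP := max_denP mC fC Creg (proj2 Qsa) hms ms0.
split=> [[/mP]//|hm]; split; first exact/mP.
by case: hm => m mms ->; apply: (sub_denominators_at fC hms).
Qed.

End Necessity.

Lemma semisimple_necessary (R : pzRingType) (hC : left_denominator (left_regular R)) :
  semisimple_artinian (loc hC) ->
  [/\ finite_set (max_den_lreg R) /\ max_den_lreg R !=set0,
      \bigcap_(S in max_den_lreg R) ass S = ass (left_regular R),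
      forall S (hS : max_den_lreg R S), simple_artinian (loc (max_den_lreg_den hS))
    & exists ha : two_sided_ideal (ass (left_regular R)),
        dense (quot_pi ha @` left_regular R) (regular (quot_ring ha))].
Proof.
move=> Qsa; have [[mC _] _] := hC; have fC := loc_in_localization hC.
have [ss art] := Qsa; have [ms [hms ms0]] := semisimple_maximal_ideals ss.
have MP T := max_den_lregP Qsa T hms ms0.
split.
- split.
    have -> : max_den_lreg R = denominators_at (loc_in hC) @` [set` ms].
      apply/seteqP; split=> T; first by move=> /MP[m mms ->]; exists m.
      by move=> [m mms <-]; apply/MP; exists m.
    exact/finite_image/finite_seq.
  apply: contrapT => nM; have [C1 _ C0] := mC.
  have /(loc_in_eq0 hC)[s Cs] : loc_in hC 1 = 0; last first.
    by rewrite mulr1 => s0; apply: C0; rewrite -s0.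
  apply: ms0 => m mms; exfalso; apply: nM.
  by exists (denominators_at (loc_in hC) m); apply/MP; exists m.
- apply/seteqP; split=> r.
    move=> hr; apply/(loc_in_eq0 hC)/ms0 => m mms.
    have : ass (denominators_at (loc_in hC) m) r by apply: hr; apply/MP; exists m.
    by rewrite (ass_denominators_at fC hms ms0 mms).
  move=> /(loc_in_eq0 hC) r0 S /MP[m mms ->].
  rewrite (ass_denominators_at fC hms ms0 mms) /= r0.
  by case: (hms _ mms) => -[[]].
- move=> S hS; have /MP[m mms e] := hS.
  exact: (loc_simple_artinian fC art hms ms0 _ mms e).
- have ha := ass_two_sided hC; exists ha.
  have [g gE] := quot_universal fC ha.
  by apply: (quot_dense mC fC gE); case: art.
Qed.

(** The map to the product of the localizations inverts the left regular
    elements; density turns its common denominators into left regular ones. *)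
Lemma semisimple_sufficient (R : pzRingType) :
  finite_set (max_den_lreg R) /\ max_den_lreg R !=set0 ->
  \bigcap_(S in max_den_lreg R) ass S = ass (left_regular R) ->
  (forall S (hS : max_den_lreg R S), simple_artinian (loc (max_den_lreg_den hS))) ->
  (exists ha : two_sided_ideal (ass (left_regular R)),
     dense (quot_pi ha @` left_regular R) (regular (quot_ring ha))) ->
  exists hC : left_denominator (left_regular R), semisimple_artinian (loc hC).
Proof.
move=> [Mfin [S0 MS0]] Mcap Msa [ha [_ _ _ dn]].
pose M := max_den_lreg R.
pose A (i : {S | M S}) : pzRingType := loc (max_den_lreg_den (proj2_sig i)).
have [f fE] := @rmorph_prod _ A R (fun i => loc_in (max_den_lreg_den (proj2_sig i))).
have ker r : f r = 0 <-> ass (left_regular R) r.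
  rewrite -Mcap; split=> [fr0 S MS|h].
    apply/(loc_in_eq0 (max_den_lreg_den MS)).
    by rewrite -(fE (exist _ S MS)) fr0 rmorph0.
  apply: prod_ext => i; rewrite fE rmorph0; apply/loc_in_eq0.
  exact: h (proj2_sig i).
have finv c : left_regular R c -> invertible (f c).
  move=> Cc; apply: prod_invertible => i; rewrite fE.
  have [li _ _] := loc_in_localization (max_den_lreg_den (proj2_sig i)).
  by apply: li; case: (proj2_sig i) => _; apply.
have fC : is_localization f (left_regular R).
  split=> // [a|r /ker //].
  have Mmax : M `<=` max_den R by move=> S [].
  have [s [r [si sr]]] :=
    @prod_common_denominator R M Mmax Mfin (@max_den_lreg_den R) Msa f fE a.
  have [|y [c Cc]] := dn (quot_pi ha s).
    split=> x; have [q <-] := quot_pi_onto x; rewrite -rmorphM.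
      move=> /(quot_pi_eq0 ha)/ker; rewrite rmorphM => /(invertible_left_regular si)/ker.
      by move/(quot_pi_eq0 ha).
    move=> /(quot_pi_eq0 ha)/ker; rewrite rmorphM => /(invertible_eq0 si)/ker.
    by move/(quot_pi_eq0 ha).
  have [q <-] := quot_pi_onto y; rewrite -rmorphM => /quot_piP/ker.
  rewrite rmorphB rmorphM => /subr0_eq cs.
  by exists c => //; exists (q * r); rewrite cs -mulrA sr rmorphM.
have mC : Defs.multiplicative (left_regular R).
  split=> [x|s t rs rt x|C0]; rewrite ?mulr1 //; first by rewrite mulrA => /rt /rs.
  have [[[[_ _ n0] _] _] _] := MS0.1.
  by apply: n0; apply: MS0.2.
exists (localization_left_denominator fC mC).
have [g gb _] := localization_iso fC
  (loc_in_localization (localization_left_denominator fC mC)).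
apply: (@semisimple_artinian_iso (prod_ring A)); first by exists g.
by apply: prod_semisimple_artinian => // i; apply: Msa.
Qed.
Local Open Scope ring_scope.

Theorem theorem3p1 (R : pzRingType) :
  let C := left_regular R in
  let a := ass C in
  let M := max_den_lreg R in
  let statement1 :=
    exists hC : left_denominator C, semisimple_artinian (loc hC) in
  let statement2 :=
    [/\ finite_set M /\ M !=set0,
        \bigcap_(S in M) ass S = a,
        forall S (hS : M S), simple_artinian (loc (max_den_lreg_den hS))
      & exists ha : two_sided_ideal a,
          dense (quot_pi ha @` C) (regular (quot_ring ha))] in
  (statement1 <-> statement2) /\
  (statement1 \/ statement2 ->
   exists ha : two_sided_ideal a,
   let Rbar : pzRingType := quot_ring ha in
   let pi : R -> Rbar := quot_pi ha in
   let Mbar := max_den Rbar in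
   (* (a) *)
   [/\ set_bij M Mbar (fun S => pi @` S),
       forall S, M S -> pi @^-1` (pi @` S) = S
     & forall T, Mbar T -> M (pi @^-1` T) /\ pi @` (pi @^-1` T) = T] /\
   (* (b) *)
   (forall S, M S -> a `<=` ass S /\ pi @` ass S = ass (pi @` S)) /\
   (forall T, Mbar T -> pi @^-1` ass T = ass (pi @^-1` T)) /\
   exists (hC : left_denominator C)
          (hbar : forall S, M S -> left_denominator (pi @` S))
          (hCbar : left_denominator (regular Rbar)),
   (* (c) *)
   (forall S (hS : M S),
      [/\ ring_iso (loc (max_den_lreg_den hS)) (loc (hbar S hS)),
          simple_artinian (loc (max_den_lreg_den hS))
        & simple_artinian (loc (hbar S hS))]) /\
   (* (d) *)
   let Q := loc hC in
   let P1 := prod_ring (fun S : {S : set R | M S} =>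
               loc (max_den_lreg_den (proj2_sig S))) in
   let P2 := prod_ring (fun S : {S : set R | M S} =>
               loc (hbar (proj1_sig S) (proj2_sig S))) in
   let P3 := prod_ring (fun T : {T : set Rbar | Mbar T} =>
               loc (max_den_den (proj2_sig T))) in
   let Qbar := loc hCbar in
   [/\ ring_iso Q P1, ring_iso P1 P2, ring_iso P2 P3 & ring_iso P3 Qbar] /\
   [/\ semisimple_artinian Q, semisimple_artinian P1, semisimple_artinian P2,
       semisimple_artinian P3 & semisimple_artinian Qbar]).
Proof.
move=> C a M statement1 statement2.
have i12 : statement1 -> statement2 by move=> [hC Qsa]; apply: semisimple_necessary Qsa.
have i21 : statement2 -> statement1.
  by move=> [h1 h2 h3 h4]; apply: semisimple_sufficient.
split=> // h12; have [hC Qsa] : statement1 by case: h12 => // /i21.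
have ha : two_sided_ideal a := ass_two_sided hC.
exists ha => Rbar pi Mbar.
have [ss art] := Qsa; have [ms [hms ms0]] := semisimple_maximal_ideals ss.
have [[mC _] _] := hC; have fC := loc_in_localization hC.
have MP T := max_den_lregP Qsa T hms ms0.
have Creg : C `<=` left_regular R by [].
have mP T := max_denP mC fC Creg art hms ms0 T.
have [g gE] := quot_universal fC ha.
have gC := quot_localization mC fC gE.
have piC := quot_regular mC fC gE.
have mpiC := quot_multiplicative mC ha.
have piCl : pi @` C `<=` left_regular Rbar by move=> c /piC [].
have MbP (T : set Rbar) := max_denP mpiC gC piCl art hms ms0 T.
pose D := denominators_at (loc_in hC); pose Db := denominators_at g.
have preD m : pi @^-1` (Db m) = D m.
  by apply/seteqP; split=> r; rewrite /Db /D /denominators_at /= gE.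
have pisurj (X : set Rbar) : pi @` (pi @^-1` X) = X.
  apply: image_preimage; apply/seteqP; split=> // b _.
  by have [r] := quot_pi_onto b; exists r.
have imD m : pi @` (D m) = Db m by rewrite -preD pisurj.
have assD m : m \in ms -> ass (D m) = loc_in hC @^-1` m.
  exact: (ass_denominators_at fC hms ms0).
have assDb m : m \in ms -> ass (Db m) = g @^-1` m.
  exact: (ass_denominators_at gC hms ms0).
have preim m : pi @^-1` (g @^-1` m) = loc_in hC @^-1` m.
  by apply/seteqP; split=> r; rewrite /= gE.
have MMb S : M S -> Mbar (pi @` S).
  by move=> /MP[m mms ->]; apply/MbP; exists m; rewrite // imD.
have preim_im S : M S -> pi @^-1` (pi @` S) = S.
  by move=> /MP[m mms ->]; rewrite imD preD.
have MbM T : Mbar T -> M (pi @^-1` T).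
  by move=> /MbP[m mms ->]; apply/MP; exists m; rewrite // preD.
have hCbar : left_denominator (regular Rbar).
  apply: (localization_left_denominator (quot_regular_localization mC fC gE (proj1 art))).
  exact: quot_regular_multiplicative.
have hbar S : M S -> left_denominator (pi @` S) by move=> /MMb[].
split; last split; last split.
- (* For (a), both sides correspond to the maximal ideals in [ms]. *)
  split=> //; last by move=> T /MbM.
  split=> [S /MMb //|S S' /set_mem MS /set_mem MS' e|T MbT].
    by rewrite -(preim_im _ MS) e preim_im.
  by exists (pi @^-1` T); [exact: MbM | rewrite pisurj].
- move=> S /MP[m mms ->]; rewrite imD assD // assDb //; split.
    move=> r /(loc_in_eq0 hC) /= ->.
    by case: (hms _ mms) => -[[]].
  by rewrite -preim pisurj.
- by move=> T /MbP[m mms ->]; rewrite preD assD // assDb // preim.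
exists hC, hbar, hCbar.
have sa S (hS : M S) : simple_artinian (loc (max_den_lreg_den hS)).
  have /MP[m mms e] := hS.
  exact: (loc_simple_artinian fC art hms ms0 _ mms e).
have sab (T : set Rbar) (hT : left_denominator T) : Mbar T -> simple_artinian (loc hT).
  by move=> /MbP[m mms e]; apply: (loc_simple_artinian gC art hms ms0 _ mms e).
split=> [S hS|Q P1 P2 P3 Qbar].
  (* For (c), both localizations are isomorphic to [Q / m]. *)
  split; [|exact: sa | exact/sab/MMb].
  have /MP[m mms e] := hS.
  have [hm _ _] := hms _ mms.
  have eb : pi @` S = Db m by rewrite e imD.
  have l1 := loc_in_localization (max_den_lreg_den hS).
  have l2 := loc_in_localization (hbar S hS).
  have k1 := denominators_at_localization fC hms ms0 hm mms.
  have k2 := denominators_at_localization gC hms ms0 hm mms.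
  apply: (@ring_iso_trans _ (quot_ring hm)).
    rewrite -e in k1; have [j jb _] := localization_iso l1 k1.
    by exists j.
  rewrite -/(Db m) -eb in k2; have [j jb _] := localization_iso k2 l2.
  by exists j.
(* For (d), each ring is compared with [Q]. *)
have svalI (T : Type) (X : set T) : injective (@sval T X).
  move=> [x hx] [y hy] /= e; subst y; congr exist; exact: Prop_irrelevance.
have QP1 : ring_iso Q P1.
  apply: (ring_iso_prod_loc mC fC Creg art hms ms0 (D := @sval _ M)) => //.
  move=> T; split=> [[[S hS] /= <-]|/mP/MP hT]; first by case: hS.
  by exists (exist _ T hT).
have QP2 : ring_iso Q P2.
  apply: (ring_iso_prod_loc mpiC gC piCl art hms ms0
    (D := fun i : {S : set R | M S} => pi @` (sval i))).
  - move=> i j /= e; apply: svalI; rewrite -(preim_im _ (proj2_sig i)) e.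
    by rewrite preim_im //; exact: proj2_sig j.
  - move=> T; split=> [[[S hS] /= <-]|hT]; first exact: MMb.
    by exists (exist _ (pi @^-1` T) (MbM _ hT)); rewrite /= pisurj.
have QP3 : ring_iso Q P3.
  apply: (ring_iso_prod_loc mpiC gC piCl art hms ms0 (D := @sval _ Mbar)).
    exact: svalI.
  move=> T; split=> [[[S hS] /= <-]|hT] //.
  by exists (exist _ T hT).
have QQb : ring_iso Q Qbar.
  have [j jb _] := localization_iso (quot_regular_localization mC fC gE (proj1 art))
    (loc_in_localization hCbar).
  by exists j.
have tr (X Y : pzRingType) : ring_iso Q X -> ring_iso Q Y -> ring_iso X Y.
  by move=> /ring_iso_sym; apply: ring_iso_trans.
have ssa (X : pzRingType) : ring_iso Q X -> semisimple_artinian X.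
  by move=> /semisimple_artinian_iso; apply.
by split; split=> //; [apply: tr | apply: tr | apply: tr | apply: ssa | apply: ssa
  | apply: ssa | apply: ssa].
Qed.
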